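(* Let $\mu\in\mathbb{N}$ and let $A\subset\mathbb{R}^{\alpha}$ be open. Let $(x,y,a)\mapsto U_a(x,y)$ be analytic on $[-1,1]^2\times A$, with $U_a(0,0)>0$ for every $a\in A$ and such that, for each $a\in A$, the Taylor series of $U_a$ at $(0,0)$ converges absolutely on $[-1,1]^2$. Let $(x,a)\mapsto V_a(x)$ be analytic on $[-1,1]\times A$ with $V_a(x)>0$ for all $(x,a)\in[-1,1]\times A$. For $\varepsilon\approx 0$ consider the family of vector fields \[ X=\frac{1}{xU_a(x,y)}\Big(x(x^\mu-\varepsilon)\partial_x-V_a(x)\,y\,\partial_y\Big). \] Let $\vartheta_\varepsilon$ denote the largest real root of $x(x^\mu-\varepsilon)=0$, i.e. $\vartheta_\varepsilon=0$ if $\varepsilon\le 0$ and $\vartheta_\varepsilon=\varepsilon^{1/\mu}$ if $\varepsilon\ge 0$. For $s>0$ small, let $\mathcal{T}(s;\varepsilon,a)$ be the time that the trajectory of $X$ starting at the point $(s+\vartheta_\varepsilon,1)\in\{y=1\}$ takes to reach the transverse section $\{x=1\}$ (the Dulac time between $\{y=1\}$ and $\{x=1\}$). Then \[ \lim_{(s,\varepsilon)\to(0^+,0)}\partial_s\mathcal{T}(s;\varepsilon,a)=-\infty \] uniformly with respect to $a$ on every compact subset of $A$.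
   Context: The point $(\vartheta_\varepsilon,0)$ is a hyperbolic saddle of $X$ for $\varepsilon\neq0$ and the family unfolds a saddle-node at $\varepsilon=0$. Equivalently, if $y=y(x;s)$ denotes the trajectory of $x(x^\mu-\varepsilon)\partial_x-V_a(x)y\partial_y$ with $y(s+\vartheta_\varepsilon;s)=1$, then $\mathcal{T}(s;\varepsilon,a)=\int_{s+\vartheta_\varepsilon}^1 \frac{U_a(x,y(x;s))}{x^\mu-\varepsilon}\,dx$ for $s\in(0,s_0]$, $|\varepsilon|\le\varepsilon_0$ with $s_0,\varepsilon_0>0$ small. *)

(* Defs.v *)
From HB Require Import structures.
From mathcomp Require Import all_boot all_order all_algebra.
From mathcomp Require Import all_classical all_reals all_analysis.
Set Implicit Arguments. Unset Strict Implicit. Unset Printing Implicit Defensive.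
Import Order.TTheory GRing.Theory Num.Theory.
Import numFieldNormedType.Exports.
Local Open Scope classical_set_scope.
Local Open Scope ring_scope.

Section Analytic.
Context {R : realType} {n : nat}.

Definition mono (k : 'I_n -> nat) (p x : 'rV[R]_n) : R :=
  \prod_(i < n) (x ord0 i - p ord0 i) ^+ k i.

Definition box_sum (c : ('I_n -> nat) -> R) (p x : 'rV[R]_n) (N : nat) : R :=
  \sum_(k : {ffun 'I_n -> 'I_N.+1})
     c (fun i => nat_of_ord (k i)) * mono (fun i => nat_of_ord (k i)) p x.

Definition box_abs_sum (c : ('I_n -> nat) -> R) (p x : 'rV[R]_n) (N : nat) : R :=
  \sum_(k : {ffun 'I_n -> 'I_N.+1})
     `| c (fun i => nat_of_ord (k i)) * mono (fun i => nat_of_ord (k i)) p x |.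

Definition ps_abs_conv (c : ('I_n -> nat) -> R) (p x : 'rV[R]_n) : Prop :=
  exists B : R, forall N, box_abs_sum c p x N <= B.

Definition ps_has_sum (c : ('I_n -> nat) -> R) (p x : 'rV[R]_n) (l : R) : Prop :=
  ps_abs_conv c p x /\ (box_sum c p x N @[N --> \oo] --> l).

Definition analytic_at (f : 'rV[R]_n -> R) (p : 'rV[R]_n) : Prop :=
  exists r : R, 0 < r /\
    exists c : ('I_n -> nat) -> R,
      forall x, ball p r x -> ps_has_sum c p x (f x).

Definition analytic_on (S : set 'rV[R]_n) (f : 'rV[R]_n -> R) : Prop :=
  forall p, S p -> analytic_at f p.

End Analytic.

Section Problem.
Context {R : realType} {alpha : nat}.

Definition pack3 (U : 'rV[R]_alpha -> R -> R -> R) : 'rV[R]_(2 + alpha) -> R :=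
  fun v => U (rsubmx v) (lsubmx v ord0 ord0) (lsubmx v ord0 ord_max).

Definition pack2 (V : 'rV[R]_alpha -> R -> R) : 'rV[R]_(1 + alpha) -> R :=
  fun v => V (rsubmx v) (lsubmx v ord0 ord0).

Definition cube_times (m : nat) (A : set 'rV[R]_alpha) : set 'rV[R]_(m + alpha) :=
  [set v | (forall i, `|lsubmx v ord0 i| <= 1) /\ A (rsubmx v)].

Definition taylor_abs_conv_square (f : R -> R -> R) : Prop :=
  exists c : ('I_2 -> nat) -> R,
    (exists r : R, 0 < r /\
       forall v : 'rV[R]_2, ball 0 r v -> ps_has_sum c 0 v (f (v ord0 ord0) (v ord0 ord_max)))
    /\ (forall v : 'rV[R]_2, (forall i, `|v ord0 i| <= 1) -> ps_abs_conv c 0 v).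

(* largest real root of x (x^mu - eps) *)
Definition theta (mu : nat) (eps : R) : R :=
  if eps <= 0 then 0 else eps `^ (mu%:R^-1).

(* trajectory y(x; s) of x(x^mu-eps) d/dx - V_a(x) y d/dy with y(s+theta;s) = 1,
   i.e. the solution of dy/dx = - V_a(x) y / (x (x^mu - eps)) *)
Definition traj (V : 'rV[R]_alpha -> R -> R) (mu : nat) (eps : R)
  (a : 'rV[R]_alpha) (s x : R) : R :=
  expR (- Rintegral (@lebesgue_measure R) `[s + theta mu eps, x]
            (fun t => V a t / (t * (t ^+ mu - eps)))).

(* Dulac time from {y = 1} to {x = 1} of the trajectory through (s + theta, 1) *)
Definition dulac_time (U : 'rV[R]_alpha -> R -> R -> R) (V : 'rV[R]_alpha -> R -> R)
  (mu : nat) (eps : R) (a : 'rV[R]_alpha) (s : R) : R :=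
  Rintegral (@lebesgue_measure R) `[s + theta mu eps, 1]
    (fun x => U a x (traj V mu eps a s x) / (x ^+ mu - eps)).

End Problem.
Arguments cube_times {R alpha} m A.

(* Main.v *)
Require Import Defs.
From HB Require Import structures.
From mathcomp Require Import all_boot all_order all_algebra.
From mathcomp Require Import all_classical all_reals all_analysis.
From mathcomp Require Import lra ring.
Import Order.TTheory GRing.Theory Num.Theory.
Import numFieldNormedType.Exports.
Local Open Scope classical_set_scope.
Local Open Scope ring_scope.

Set Implicit Arguments.
Unset Strict Implicit.
Unset Printing Implicit Defensive.

(** Write [sg = s + theta], [q(x) = x^mu - eps] and let [y(x)] be the trajectory
    with [y(sg) = 1], so that [- y' = V y / (x q)].  Differentiating the integral,
    [q(sg) * dT/ds = - U(sg, 1) + int_sg^1 (x V(sg) / (sg V(x))) U_y(x, y) (- y') dx].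
    While [x] is small, [x] varies much more slowly than [y], so the weight
    [x V(sg) / (sg V(x))] stays close to 1 until [y] is negligible and the
    integral is close to [U(sg, 1) - U(sg, 0)].  Hence [q(sg) * dT/ds] is at most
    [- U(0, 0) / 2], whereas [q(sg)] tends to [0] from above.  Compactness makes
    all the constants uniform in [a]; analyticity enters only through the joint
    continuity of [V], [U] and [U_y]. *)

(** That [x] is slow means [y <= kap * x * (- y')], that is [q <= kap * V], which holds on
    [[sg, d1]] once [d1] and [eps] are small against [kap]. With [kap <= 1/2] it yields
    [y(d1) <= (sg / d1)^2]. The second power matters: beyond [d1] the weight may reach a multiple of
    [1 / sg], so only a quadratic bound on [y] leaves a contribution of order [sg]. Since [U_y] has
    no sign, the excess of the weight over 1 cannot be discarded. It is absorbed by the term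
    [(x / sg - 1 + kap) * y], whose value at [sg] is only [kap]. What survives the cancellation of
    [U(sg, 1)] is [- U(sg, y(d1))], taken near the origin, the only place where [U] is known to be
    positive. A separate obstacle is that [y = 1] bounds the domain of [U]: when the start moves to
    the right while the integration segment stays fixed, the trajectory passes above [y = 1]. Hence
    [U] must be differentiated in a tube reaching slightly beyond the square. *)

Lemma is_derive_little (R : realType) (f : R -> R) (a l : R) :
  (forall e : R, 0 < e ->
    \forall x \near a, `|f x - f a - l * (x - a)| <= e * `|x - a|) ->
  is_derive a 1 f l.
Proof.
move=> H.
suff L : h^-1 *: (f (h + a) - f a) @[h --> 0^'] --> l.
  have D : derivable f a 1.
    by apply/cvg_ex; exists l; under eq_fun do rewrite scaler1.
  by apply: DeriveDef => //; rewrite -derive1E /derive1; exact: cvg_lim L.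
apply/cvgrPdist_le => e e0; have [d /= d0 Hd] := H e e0.
near=> h.
have h0 : h != 0 by near: h; exact: nbhs_dnbhs_neq.
have hd : `|h| < d by near: h; exact: dnbhs0_lt.
have /Hd : ball a d (h + a) by rewrite /ball /= opprD addrCA subrr addr0 normrN.
rewrite addrK => le.
rewrite -(ler_pM2r (x := `|h|)) ?normr_gt0// distrC -normrM mulrBl.
by rewrite /GRing.scale /= mulrAC mulVf// mul1r.
Unshelve. all: by end_near. Qed.

(** * Comparison of integrals with primitives *)

Section integrals_of_continuous_functions.
Context {R : realType}.
Notation leb := (@lebesgue_measure R).
Implicit Types f : R -> R.

Lemma integrable_continuous_segment f (a b : R) :
  (forall x, a <= x <= b -> {for x, continuous f}) ->
  leb.-integrable `[a, b] (EFin \o f).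
Proof.
move=> cf; apply: continuous_compact_integrable; first exact: segment_compact.
apply: continuous_in_subspaceT => x /set_mem/=; rewrite in_itv/=; exact: cf.
Qed.

Lemma Rintegral_segment_split f (a b c : R) : a <= b <= c ->
  (forall x, a <= x <= c -> {for x, continuous f}) ->
  \int[leb]_(x in `[a, c]) f x =
  \int[leb]_(x in `[a, b]) f x + \int[leb]_(x in `[b, c]) f x.
Proof.
move=> /andP[ab bc] cf; have intf := integrable_continuous_segment cf.
rewrite -(@Rintegral_itv_obnd_cbnd R b); last first.
  apply: (integrableS _ _ _ intf) => //.
  apply: subset_itvr; by rewrite bnd_simp.
rewrite -(@Rintegral_itvB R f (BLeft a) (BRight c) b) ?bnd_simp//.
by rewrite addrC subrK.
Qed.

(* The derivative of [Psi] need not be integrable: the comparison is between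
   [Psi] and the primitive of [f]. *)
Lemma Rintegral_le_of_derive f (Psi psi : R -> R) (a b : R) : a <= b ->
  (forall x, a <= x <= b -> {for x, continuous f}) ->
  (forall x, a <= x <= b -> is_derive x 1 Psi (psi x)) ->
  (forall x, a < x < b -> f x <= psi x) ->
  \int[leb]_(x in `[a, b]) f x <= Psi b - Psi a.
Proof.
move=> ab cf dPsi le.
have [->|neab] := eqVneq a b.
  by rewrite set_itv1 Rintegral_set1 subrr.
have {neab} altb : a < b by rewrite lt_neqAle neab.
have intf := integrable_continuous_segment cf.
have [F [Fa Fb Fc dF]] : exists F : R -> R, [/\ F a = 0,
    F b = \int[leb]_(x in `[a, b]) f x, {within `[a, b], continuous F}
    & forall x, a < x < b -> is_derive x 1 F (f x)].
  exists (fun x => \int[leb]_(t in `[a, x]) f t); split => //.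
  - by rewrite set_itv1 Rintegral_set1.
  - exact: (parameterized_integral_continuous ab intf).
  - move=> x /andP[ax xb].
    have cfx : {for x, continuous f} by apply: cf; rewrite !ltW.
    have [D1 D2] := continuous_FTC1_closed xb intf ax cfx.
    by apply: (DeriveDef D1); rewrite -derive1E D2.
have D x : x \in `]a, b[ -> is_derive x 1 (Psi - F) (psi x - f x).
  rewrite in_itv/= => xab; have H1 := dF _ xab.
  have H2 : is_derive x 1 Psi (psi x).
    by apply: dPsi; move: xab => /andP[? ?]; rewrite !ltW.
  exact: is_deriveB.
have mono : {in `[a, b] &, {homo (Psi - F) : x y / x <= y}}.
  apply: ger0_derive1_le_cc => [x xab|x xab|].
  - by have [] := D _ xab.
  - have [_ Dv] := D _ xab; rewrite derive1E Dv subr_ge0.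
    by apply: le; move: xab; rewrite in_itv.
  - apply: within_continuousB => //.
    apply: continuous_in_subspaceT => x /set_mem/=; rewrite in_itv/= => xab.
    by apply: differentiable_continuous; apply/derivable1_diffP; have [] := dPsi _ xab.
have := mono a b; rewrite !in_itv/= !lexx ab => /(_ isT isT isT).
rewrite !fctE Fa Fb subr0 => H.
by rewrite lerBrDr addrC -lerBrDr.
Qed.
End integrals_of_continuous_functions.

(** * Leibniz's rule with a moving lower end *)

Section leibniz_rule.
Context {R : realType}.
Notation leb := (@lebesgue_measure R).

(** [E] is based at [m], so a two-sided derivative is available only strictly to the right of [m];
    this is the origin of the strict inequalities on [m] below. *)
Lemma continuous_primitive (g : R -> R) (m : R) :
  (forall x, m <= x -> {for x, continuous g}) ->
  exists E : R -> R, (forall x, m < x -> is_derive x 1 E (g x)) /\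
    (forall a b, m <= a -> a <= b ->
      \int[leb]_(t in `[a, b]) g t = E b - E a).
Proof.
move=> cg; exists (fun x => \int[leb]_(t in `[m, x]) g t); split.
  move=> x mx; have xx1 : x < x + 1 by rewrite ltrDl.
  have intg : leb.-integrable `[m, x + 1] (EFin \o g).
    by apply: integrable_continuous_segment => t /andP[? _]; exact: cg.
  have [D1 D2] := continuous_FTC1_closed xx1 intg mx (cg _ (ltW mx)).
  by apply: (DeriveDef D1); rewrite -derive1E D2.
move=> a b ma ab; rewrite (@Rintegral_segment_split _ _ m a b) ?ma//.
  by rewrite [X in X - _]addrC addrK.
by move=> t /andP[? _]; exact: cg.
Qed.

Lemma is_derive_continuous (f : R -> R) (x l : R) :
  is_derive x 1 f l -> {for x, continuous f}.
Proof.
by move=> [D _]; apply: differentiable_continuous; exact/derivable1_diffP.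
Qed.

(** Near each point of [S] every large enough [M] is a bound; the near-covering form of compactness,
    with the filter at infinity, turns this into one [M] for all of [S]. *)
Lemma continuous_bounded_compact (T : topologicalType) (S : set T) (f : T -> R) :
  compact S -> (forall q, S q -> {for q, continuous f}) ->
  exists M : R, forall q, S q -> `|f q| <= M.
Proof.
move=> /(compact_near_coveringP _).1 cpt cf.
have := cpt _ (+oo : set_system R) (fun M q => `|f q| <= M) _.
case=> [q Sq|M [_ HM]].
  near=> q' M => /=.
  have H : `|f q' - f q| < 1.
    near: q'; have /cvgrPdist_lt/(_ _ ltr01) := cf _ Sq.
    by apply: filterS => t /=; rewrite distrC.
  apply: (@le_trans _ _ (`|f q| + 1)).
    by rewrite -lerBlDl; apply: le_trans (ltW H); exact: lerB_dist.
  by near: M; apply: nbhs_pinfty_ge; rewrite num_real.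
by exists (M + 1) => q Sq; apply: (HM (M + 1)) => //; rewrite ltrDl.
Unshelve. all: by end_near. Qed.

Lemma continuous_bounded_rectangle (f : R -> R -> R) (a b c d : R) :
  (forall x y, a <= x <= b -> c <= y <= d ->
    {for (x, y), continuous (fun p : R * R => f p.1 p.2)}) ->
  exists M : R, forall x y, a <= x <= b -> c <= y <= d -> `|f x y| <= M.
Proof.
move=> cf.
have cpt : compact (`[a, b]%classic `*` `[c, d]%classic : set (R * R)).
  by apply: compact_setX; exact: segment_compact.
have [|M HM] := @continuous_bounded_compact _ _ (fun p => f p.1 p.2) cpt.
  by move=> [x y] [/=]; rewrite !in_itv/=; exact: cf.
by exists M => x y xab ycd; apply: (HM (x, y)); split; rewrite /= in_itv.
Qed.

Lemma derive_ge0_nondecreasing (f g : R -> R) (m x y : R) :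
  (forall x, m < x -> is_derive x 1 f (g x)) -> (forall x, m < x -> 0 <= g x) ->
  m < x -> x <= y -> f x <= f y.
Proof.
move=> df g0 mx xy; rewrite -subr_ge0.
have [||c + ->] := @MVT_segment R f g x y xy.
- by move=> z; rewrite in_itv/= => /andP[xz _]; apply: df; exact: lt_trans xz.
- apply: continuous_in_subspaceT => z /set_mem/=; rewrite in_itv/= => /andP[xz _].
  by apply: is_derive_continuous; apply: df; exact: lt_le_trans xz.
- rewrite in_itv/= => /andP[xc _]; rewrite mulr_ge0 ?subr_ge0//.
  by apply: g0; exact: lt_le_trans xc.
Qed.

(** Up to sign, [F - P] is the integral of [f z] over the thin segment between [c] and [z]; joint
    continuity at [(c, c)] makes it [- f c c * (z - c)] up to [e * |z - c|]. Only [P], whose ends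
    are fixed, is left for differentiation under the integral sign. *)
Lemma is_derive_moving_end (f : R -> R -> R) (P F : R -> R) (c l b : R) :
  c < b ->
  {for (c, c), continuous (fun p : R * R => f p.1 p.2)} ->
  (\forall z \near c, forall x, (z <= x) || (c <= x) -> x <= b ->
    {for x, continuous (f z)}) ->
  (forall z, F z = \int[leb]_(x in `[z, b]) f z x) ->
  (forall z, P z = \int[leb]_(x in `[c, b]) f z x) ->
  is_derive c 1 P l -> is_derive c 1 F (l - f c c).
Proof.
move=> cb cf cfz FE PE dP.
have -> : F = P + (F - P) by rewrite addrC subrK.
apply: is_deriveD; apply: is_derive_little => e e0.
have : \forall z \near c & x \near c, `|f z x - f c c| <= e.
  have /cvgrPdist_le/(_ _ e0) := cf.
  by apply: filterS => p /=; rewrite distrC.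
case=> [[A B]] /= [[dA dA0 HA] [dB dB0 HB]] H.
near=> z.
have zA : A z by near: z; exists dA.
have zB x : `|x - c| <= `|z - c| -> B x.
  move=> xz; apply: HB => /=; rewrite distrC; apply: le_lt_trans xz _.
  by near: z; exists dB => //= t; rewrite /ball /= distrC.
have zb : z < b by near: z; exact: lt_nbhsl.
have cz : forall x, (z <= x) || (c <= x) -> x <= b ->
    {for x, continuous (f z)} by near: z.
have bnd x : `|x - c| <= `|z - c| -> - (e - f c c) <= f z x <= f c c + e.
  move=> /zB xB; have /= := H (z, x) (conj zA xB).
  by rewrite ler_norml => /andP[? ?]; apply/andP; split; lra.
rewrite !fctE.
have -> : F c - P c = 0 by rewrite FE PE subrr.
rewrite subr0 mulNr opprK FE PE.
(* Serves both sides of [c]: [[u, v]] is [[z, c]] or [[c, z]]. Comparison with the linear functions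
   of slopes [f c c + e] and [e - f c c] bounds the integral and its opposite. *)
have est u v : u <= v -> v <= b -> (z <= u) || (c <= u) -> `|v - u| = `|z - c| ->
   (forall x, u <= x <= v -> `|x - c| <= `|z - c|) ->
   `|\int[leb]_(x in `[u, v]) f z x - f c c * (v - u)| <= e * `|z - c|.
  move=> uv vb zu vuE ux.
  have cuv x : u <= x <= v -> {for x, continuous (f z)}.
    move=> /andP[ux' xv]; apply: cz; last exact: le_trans vb.
    by case/orP: zu => zu; rewrite (le_trans zu ux') ?orbT.
  have bnd' x : u < x < v -> - (e - f c c) <= f z x <= f c c + e.
    by move=> /andP[? ?]; apply/bnd/ux; rewrite !ltW.
  have up : \int[leb]_(x in `[u, v]) f z x <= (f c c + e) * v - (f c c + e) * u.
    apply: (@Rintegral_le_of_derive _ _ (fun x => (f c c + e) * x)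
      (fun=> f c c + e) u v uv cuv).
    - by move=> x _; apply: is_derive_eq; rewrite /GRing.scale/= mulr1.
    - by move=> x /bnd' /andP[].
  have lo : \int[leb]_(x in `[u, v]) (- f z x) <= (e - f c c) * v - (e - f c c) * u.
    apply: (@Rintegral_le_of_derive _ _ (fun x => (e - f c c) * x)
      (fun=> e - f c c) u v uv).
    - by move=> x xuv; apply: continuousN; exact: cuv.
    - by move=> x _; apply: is_derive_eq; rewrite /GRing.scale/= mulr1.
    - by move=> x /bnd' /andP[? _]; rewrite lerNl.
  have lo' : - (\int[leb]_(x in `[u, v]) f z x) <= (e - f c c) * v - (e - f c c) * u.
    move: lo; under eq_Rintegral do rewrite -mulN1r.
    rewrite RintegralZl ?mulN1r//; exact: integrable_continuous_segment.
  rewrite -vuE (ger0_norm (_ : 0 <= v - u)) ?subr_ge0//.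
  rewrite ler_norml; apply/andP; split; lra.
have [zc|cz'] := leP z c.
- rewrite (@Rintegral_segment_split _ (f z) z c b) ?zc ?(ltW cb)//; last first.
    by move=> x /andP[zx xb]; apply: cz => //; rewrite zx.
  have -> : f c c * (z - c) = - (f c c * (c - z)) by rewrite -mulrN opprB.
  rewrite addrK; apply: est => //; first exact: ltW.
  - by rewrite lexx.
  - exact: distrC.
  - move=> x /andP[? ?]; rewrite !ler0_norm ?subr_le0//; lra.
- rewrite (@Rintegral_segment_split _ (f z) c z b) ?(ltW cz') ?(ltW zb)//; last first.
    by move=> x /andP[zx xb]; apply: cz => //; rewrite zx orbT.
  rewrite [X in _ - X]addrC opprD addrA subrr sub0r -normrN opprD opprK.
  apply: est => //; [exact: ltW|exact: ltW|by rewrite lexx orbT|].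
  move=> x /andP[? ?]; rewrite !ger0_norm ?subr_ge0//; lra.
Unshelve. all: by end_near. Qed.

End leibniz_rule.

Lemma continuous_comp2 (T U V W : topologicalType) (f : T -> U) (g : T -> V)
    (h : U -> V -> W) (x : T) :
  {for x, continuous f} -> {for x, continuous g} ->
  {for (f x, g x), continuous (fun p => h p.1 p.2)} ->
  {for x, continuous (fun t => h (f t) (g t))}.
Proof. by move=> cf cg ch; apply: (cvg_comp2 cf cg ch). Qed.

(** * Dependence of the time integral on the starting point *)

Section derivative_along_flow.
Context {R : realType}.
Notation leb := (@lebesgue_measure R).
Variables (m b r c : R) (E g h : R -> R) (W Wy : R -> R -> R).
Hypotheses (r0 : 0 < r) (mc : m < c) (cb : c < b).
Hypothesis dE : forall x, m < x -> is_derive x 1 E (g x).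
Hypothesis g_ge0 : forall x, m < x -> 0 <= g x.
Hypothesis cg : forall x, m < x -> {for x, continuous g}.
Hypothesis ch : forall x, m < x -> {for x, continuous h}.
Hypothesis cW : forall x y : R, m < x -> 0 < y -> y < 1 + r ->
  {for (x, y), continuous (fun p : R * R => W p.1 p.2)}.
Hypothesis cWy : forall x y : R, m < x -> 0 < y -> y < 1 + r ->
  {for (x, y), continuous (fun p : R * R => Wy p.1 p.2)}.
Hypothesis dW : forall x y : R, m < x -> 0 < y -> y < 1 + r ->
  is_derive y 1 (W x) (Wy x y).

Let Z z x := expR (E z - E x).
Let f z x := W x (Z z x) * h x.
Let df z x := Wy x (Z z x) * (Z z x * g z) * h x.

Let cE x : m < x -> {for x, continuous E}.
Proof. by move=> mx; exact: is_derive_continuous (dE mx). Qed.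

Let le_E x y : m < x -> x <= y -> E x <= E y.
Proof. exact: derive_ge0_nondecreasing. Qed.

Let cZ z x : m < z -> m < x -> {for (z, x), continuous (fun p : R * R => Z p.1 p.2)}.
Proof.
move=> mz mx; rewrite /Z.
apply: (@continuous_comp _ _ _ (fun p : R * R => E p.1 - E p.2) expR); last first.
  exact: continuous_expR.
apply: continuousB.
- apply: (@continuous_comp _ _ _ fst E); [exact: cvg_fst|exact: cE].
- apply: (@continuous_comp _ _ _ snd E); [exact: cvg_snd|exact: cE].
Qed.

Let c_comp2 (F : R -> R -> R) z x : m < z -> m < x ->
  {for (x, Z z x), continuous (fun p : R * R => F p.1 p.2)} ->
  {for (z, x), continuous (fun p : R * R => F p.2 (Z p.1 p.2))}.
Proof.
move=> mz mx cF.
apply: (@continuous_comp2 _ _ _ _ snd (fun p => Z p.1 p.2) F).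
- exact: cvg_snd.
- exact: cZ.
- exact: cF.
Qed.

Let cf z x : m < z -> m < x -> Z z x < 1 + r ->
  {for (z, x), continuous (fun p : R * R => f p.1 p.2)}.
Proof.
move=> mz mx Zr; apply: continuousM.
  by apply: (c_comp2 mz mx); apply: cW => //; exact: expR_gt0.
by apply: (@continuous_comp _ _ _ snd h); [exact: cvg_snd|exact: ch].
Qed.

Let cdf z x : m < z -> m < x -> Z z x < 1 + r ->
  {for (z, x), continuous (fun p : R * R => df p.1 p.2)}.
Proof.
move=> mz mx Zr; apply: continuousM; last first.
  by apply: (@continuous_comp _ _ _ snd h); [exact: cvg_snd|exact: ch].
apply: continuousM.
  by apply: (c_comp2 mz mx); apply: cWy => //; exact: expR_gt0.
apply: continuousM; first exact: cZ.
by apply: (@continuous_comp _ _ _ fst g); [exact: cvg_fst|exact: cg].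
Qed.

Let c_slice (F : R -> R -> R) (z x : R) :
  {for (z, x), continuous (fun p : R * R => F p.1 p.2)} ->
  {for x, continuous (F z)}.
Proof.
move=> cF; apply: (@continuous_comp2 _ _ _ _ (cst z) id F).
- exact: cvg_cst.
- exact: cvg_id.
- exact: cF.
Qed.

Let dfE z x : m < z -> m < x -> Z z x < 1 + r -> is_derive z 1 (f^~ x) (df z x).
Proof.
move=> mz mx Zr.
have dZ : is_derive z 1 (Z^~ x) (Z z x * g z).
  apply: (@is_derive1_comp R expR (fun z => E z - E x)).
  have H := dE mz.
  by apply: is_derive_eq; rewrite subr0.
have dWZ := @is_derive1_comp R (W x) (Z^~ x) z _ _ (dW mx (expR_gt0 _) Zr) dZ.
have -> : f^~ x = (W x \o Z^~ x) * cst (h x) by apply/funext.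
apply: is_derive_eq.
rewrite /df /GRing.scale/= mulr0 add0r mulrC; congr (_ * _).
Qed.

(** For [c <= x < z] the value [Z z x] may exceed 1, and the margin [r] must contain it. As [E] is
    nondecreasing, the worst case is [x = c], where continuity of [E] gives
    [expR (E z - E c) < 1 + r]. *)
Let near_c : exists2 d : R, 0 < d & forall z, `|z - c| <= d ->
  m < z /\ forall x, (z <= x) || (c <= x) -> m < x /\ Z z x < 1 + r.
Proof.
have : \forall z \near c, m < z /\ expR (E z - E c) < 1 + r.
  near=> z; split; first by near: z; exact: lt_nbhsr.
  near: z.
  have cc : {for c, continuous (fun z => expR (E z - E c))}.
    apply: (@continuous_comp _ _ _ (fun z => E z - E c) expR); last exact: continuous_expR.
    by apply: continuousB; [exact: cE|exact: cvg_cst].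
  apply: (cvgr_lt _ cc); by rewrite subrr expR0 ltrDl.
case=> d /= d0 H; exists (d / 2); first by rewrite divr_gt0.
move=> z zd; have [|mz Zr] := H z.
  by rewrite /= distrC (le_lt_trans zd)// ltr_pdivrMr// ltr_pMr// ltr1n.
split => // x /orP[zx|cx].
- split; first exact: lt_le_trans zx.
  apply: (@le_lt_trans _ _ 1); last by rewrite ltrDl.
  by rewrite -expR0 ler_expR subr_le0; exact: le_E.
- split; first exact: lt_le_trans cx.
  by apply: le_lt_trans Zr; rewrite ler_expR lerD2l lerN2; exact: le_E.
Unshelve. all: by end_near. Qed.

(** In the form [expR (E z - E x)] the trajectory depends on its start only through [E z], so its
    derivative is itself times [g z]. The boundary term carries [W c 1] because the trajectory
    starts at height 1. *)
Lemma is_derive_integral_along_flow :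
  is_derive c 1 (fun z => \int[leb]_(x in `[z, b]) (W x (expR (E z - E x)) * h x))
    (\int[leb]_(x in `[c, b])
       (Wy x (expR (E c - E x)) * (expR (E c - E x) * g c) * h x)
     - W c 1 * h c).
Proof.
have [d d0 near_d] := near_c.
have dd (z x : R) : c - d < z < c + d -> c <= x ->
    [/\ m < z, m < x & Z z x < 1 + r].
  move=> zcd cx; have [|mz /(_ x)] := near_d z.
    by rewrite ler_norml; lra.
  by rewrite cx orbT => -[].
have Zcc : Z c c = 1 by rewrite /Z subrr expR0.
have -> : W c 1 * h c = f c c by rewrite /f Zcc.
apply: (@is_derive_moving_end R f (fun z => \int[leb]_(x in `[c, b]) f z x)) => //.
- exact: cb.
- by apply: cf => //; rewrite Zcc ltrDl.
- exists d => //= z; rewrite /= distrC => /ltW /near_d [mz H] x /H[mx Zr] _.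
  exact: (@c_slice f) (cf _ _ _).
(* Halving [d] gives a closed rectangle inside the region where [df] is continuous; the resulting
   constant is the dominating function for differentiation under the integral. *)
have [M HM] : exists M : R, forall z x : R, c - d / 2 <= z <= c + d / 2 -> c <= x <= b ->
    `|df z x| <= M.
  apply: continuous_bounded_rectangle => z x zcd /andP[cx _].
  by have [|? ? ?] := dd z x _ cx; [lra|exact: cdf].
have Ic : `]c - d / 2, c + d / 2[%classic c by rewrite /= in_itv/=; lra.
have intf (z : R) : `]c - d / 2, c + d / 2[%classic z ->
    leb.-integrable `[c, b] (EFin \o f z).
  rewrite /= in_itv/= => zcd.
  apply: integrable_continuous_segment => x /andP[cx _].
  by have [|? ? ?] := dd z x _ cx; [lra|exact: (@c_slice f) (cf _ _ _)].
have derf (z x : R) : `]c - d / 2, c + d / 2[%classic z -> `[c, b]%classic x ->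
    is_derive z 1 (f^~ x) (df z x).
  rewrite /= !in_itv/= => zcd /andP[cx _].
  by have [|? ? ?] := dd z x _ cx; [lra|exact: dfE].
have derf1 (z x : R) : `]c - d / 2, c + d / 2[%classic z ->
    `[c, b]%classic x -> derivable (f^~ x) z 1.
  by move=> zc xc; have [] := derf z x zc xc.
have M0 : forall x : R, 0 <= `|M| by move=> _; exact: normr_ge0.
have intM : leb.-integrable `[c, b] (EFin \o (fun _ : R => `|M|)).
  by apply: integrable_continuous_segment => x _; exact: cvg_cst.
have d1E (z x : R) : `]c - d / 2, c + d / 2[%classic z ->
    `[c, b]%classic x -> partial1of2 f z x = df z x.
  by move=> zc xc; rewrite partial1of2E; have [_ ->] := derf z x zc xc.
have G_ub (z x : R) : `]c - d / 2, c + d / 2[%classic z ->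
    `[c, b]%classic x -> `|partial1of2 f z x| <= `|M|.
  move=> zc xc; rewrite d1E//; apply: le_trans (ler_norm M).
  by apply: HM; move: zc xc; rewrite /= !in_itv/= => /andP[? ?] ?//; rewrite !ltW.
have D1 := @derivable_under_integral R _ _ leb f `[c, b]%classic
  (measurable_itv _) c _ _ Ic intf derf1 _ M0 intM G_ub.
have D2 := @differentiation_under_integral R _ _ leb f `[c, b]%classic
  (measurable_itv _) c _ _ Ic intf derf1 _ M0 intM G_ub.
apply: (DeriveDef D1); rewrite -derive1E D2.
by apply: eq_Rintegral => x /set_mem xc; rewrite d1E.
Qed.

End derivative_along_flow.

(** * Partial derivatives of analytic functions from bounds on their coefficients *)

Section power_estimates.
Context {R : realType}.
Implicit Types z w : R.

Lemma exprn_le1_half z k : `|z| <= 1/2 -> `|z ^+ k| <= 1.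
Proof.
by move=> z2; rewrite normrX exprn_ile1//; lra.
Qed.

(** On [[-1/2, 1/2]] the constants can be independent of the degree, because each induction step
    multiplies the previous one by 1/2. They are the fixed points of [C = C / 2 + 1] here and for
    the derivative, of [C = C / 2 + 4] for its Lipschitz bound, and of [C = C / 2 + 2] for the
    Taylor bound. *)
Lemma exprn_lipschitz_half z w k : `|z| <= 1/2 -> `|w| <= 1/2 ->
  `|z ^+ k - w ^+ k| <= 2 * `|z - w|.
Proof.
move=> z2 w2; elim: k => [|k IH]; first by rewrite !expr0 subrr normr0 mulr_ge0.
have -> : z ^+ k.+1 - w ^+ k.+1 = z * (z ^+ k - w ^+ k) + (z - w) * w ^+ k.
  by rewrite !exprS; ring.
apply: le_trans (ler_normD _ _) _; rewrite !normrM.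
have := exprn_le1_half k w2; move: IH (normr_ge0 (z - w)) (normr_ge0 z).
move: (normr_ge0 (w ^+ k)) (normr_ge0 (z ^+ k - w ^+ k)).
by move: `|_ - _| `|w ^+ k| `|z - w| `|z| z2 => A B C D; nra.
Qed.

(** The product rule for [z * z ^+ k]. At [k = 0] the multiple [*+ k] is 0, so the truncated
    predecessor does no harm. *)
Lemma exprn_derivS z k : z ^+ k.+1.-1 *+ k.+1 = z ^+ k + z * (z ^+ k.-1 *+ k).
Proof.
by case: k => [|k] /=; rewrite ?mulr0n ?mulr0 ?addr0// mulrS exprS mulrnAr.
Qed.

Lemma exprn_deriv_le2_half z k : `|z| <= 1/2 -> `|z ^+ k.-1 *+ k| <= 2.
Proof.
move=> z2; elim: k => [|k IH]; first by rewrite mulr0n normr0.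
rewrite exprn_derivS; apply: le_trans (ler_normD _ _) _; rewrite !normrM.
have := exprn_le1_half k z2; move: IH (normr_ge0 z) (normr_ge0 (z ^+ k.-1 *+ k)).
by move: `|_ *+ _| `|z ^+ k| `|z| z2 => A B C; nra.
Qed.

Lemma exprn_deriv_lipschitz_half z w k : `|z| <= 1/2 -> `|w| <= 1/2 ->
  `|z ^+ k.-1 *+ k - w ^+ k.-1 *+ k| <= 8 * `|z - w|.
Proof.
move=> z2 w2; elim: k => [|k IH]; first by rewrite !mulr0n subrr normr0 mulr_ge0.
have -> : z ^+ k.+1.-1 *+ k.+1 - w ^+ k.+1.-1 *+ k.+1 =
    (z ^+ k - w ^+ k) + z * (z ^+ k.-1 *+ k - w ^+ k.-1 *+ k)
    + (z - w) * (w ^+ k.-1 *+ k).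
  by rewrite !exprn_derivS; ring.
apply: le_trans (ler_normD _ _) _; apply: le_trans (lerD (ler_normD _ _) (lexx _)) _.
rewrite !normrM.
have := exprn_lipschitz_half k z2 w2; have := exprn_deriv_le2_half k w2.
move: IH (normr_ge0 (z - w)) (normr_ge0 z).
move: (normr_ge0 (w ^+ k.-1 *+ k)) (normr_ge0 (z ^+ k.-1 *+ k - w ^+ k.-1 *+ k)).
by move: `|_ *+ _ - _ *+ _| `|_ *+ _| `|_ ^+ k - _| `|z - w| `|z| z2 => A B C D F; nra.
Qed.

Lemma exprn_taylor_half z w k : `|z| <= 1/2 -> `|w| <= 1/2 ->
  `|w ^+ k - z ^+ k - (w - z) * (z ^+ k.-1 *+ k)| <= 4 * (w - z) ^+ 2.
Proof.
move=> z2 w2; elim: k => [|k IH].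
  by rewrite !expr0 subrr mulr0n mulr0 subr0 normr0 mulr_ge0// sqr_ge0.
have -> : w ^+ k.+1 - z ^+ k.+1 - (w - z) * (z ^+ k.+1.-1 *+ k.+1) =
    z * (w ^+ k - z ^+ k - (w - z) * (z ^+ k.-1 *+ k))
    + (w - z) * (w ^+ k - z ^+ k).
  by rewrite !exprn_derivS !exprS; ring.
apply: le_trans (ler_normD _ _) _; rewrite !normrM.
have := exprn_lipschitz_half k w2 z2; move: IH; rewrite -(real_normK (num_real (w - z))).
move: (normr_ge0 (w - z)) (normr_ge0 z) (normr_ge0 (w ^+ k - z ^+ k)).
move: (normr_ge0 (w ^+ k - z ^+ k - (w - z) * (z ^+ k.-1 *+ k))).
by move: `|_ - _ * _| `|_ ^+ k - _| `|w - z| `|z| z2 => A B C D; nra.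
Qed.

Lemma prod_le1 n (u : 'I_n -> R) (P : pred 'I_n) :
  (forall j, `|u j| <= 1) -> `|\prod_(j | P j) u j| <= 1.
Proof.
move=> u1; rewrite normr_prod; apply: prodr_ile1 => j _; by rewrite normr_ge0 u1.
Qed.

Lemma prod_lipschitz n (u v : 'I_n -> R) (d : R) :
  (forall j, `|u j| <= 1) -> (forall j, `|v j| <= 1) ->
  (forall j, `|u j - v j| <= d) ->
  `|\prod_j u j - \prod_j v j| <= n%:R * d.
Proof.
elim: n u v => [|n IH] u v u1 v1 uv; first by rewrite !big_ord0 subrr normr0 mul0r.
rewrite !big_ord_recl.
set U := \prod_(_ < _) _; set V := \prod_(_ < _) v _.
have -> : u ord0 * U - v ord0 * V = u ord0 * (U - V) + (u ord0 - v ord0) * V by ring.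
apply: le_trans (ler_normD _ _) _; rewrite !normrM -natr1 mulrDl mul1r.
apply: lerD.
  rewrite -[leRHS]mul1r; apply: ler_pM => //.
  by apply: IH.
rewrite -[leRHS]mulr1; apply: ler_pM => //.
exact: (@prod_le1 _ (fun j => v (lift ord0 j))).
Qed.
End power_estimates.

Section power_series_in_the_half_cube.
Context {R : realType} {n : nat}.
Variables (c : ('I_n -> nat) -> R) (B : R).
Notation ix N := {ffun 'I_n -> 'I_N.+1}.
Notation ex k := (fun j => nat_of_ord (k j)).
Hypothesis cB : forall N, \sum_(k : ix N) `|c (ex k)| <= B.
Implicit Types z w : 'I_n -> R.

Definition box_poly N z : R := \sum_(k : ix N) c (ex k) * \prod_j z j ^+ k j.

(* Half of the derivative of [box_poly] in the variable [i]: the factor 1/2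
   keeps all the factors of the monomials in [-1, 1]. *)
Definition box_poly_diff (i : 'I_n) N z : R := \sum_(k : ix N) c (ex k) *
  \prod_j (if j == i then (z j ^+ (k j).-1 *+ k j) / 2 else z j ^+ k j).

Let cB_ge0 : 0 <= B.
Proof. by apply: le_trans (cB 0); exact: sumr_ge0. Qed.

Let sum_bound N (t : ix N -> R) (d : R) : (forall k, `|t k| <= d) ->
  `|\sum_(k : ix N) c (ex k) * t k| <= B * d.
Proof.
move=> td; apply: le_trans (ler_norm_sum _ _ _) _.
apply: (@le_trans _ _ (\sum_(k : ix N) `|c (ex k)| * d)).
  by apply: ler_sum => k _; rewrite normrM ler_wpM2l.
rewrite -mulr_suml ler_wpM2r//.
by apply: le_trans (normr_ge0 _) (td [ffun=> ord0]).
Qed.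

Lemma box_poly_lipschitz N z w (d : R) :
  (forall j, `|z j| <= 1/2) -> (forall j, `|w j| <= 1/2) ->
  (forall j, `|z j - w j| <= d) ->
  `|box_poly N z - box_poly N w| <= B * (n%:R * (2 * d)).
Proof.
move=> z2 w2 zw; rewrite -sumrB.
under eq_bigr do rewrite -mulrBr.
apply: sum_bound => k; apply: prod_lipschitz => j; [exact: exprn_le1_half..|].
by apply: le_trans (exprn_lipschitz_half _ _ _) _ => //; rewrite ler_pM2l.
Qed.

Let diff_factor_le1 (i : 'I_n) z (k : 'I_n -> nat) j : (forall j, `|z j| <= 1/2) ->
  `|if j == i then (z j ^+ (k j).-1 *+ k j) / 2 else z j ^+ k j| <= 1.
Proof.
move=> z2; case: ifP => _; last exact: exprn_le1_half.
by rewrite normf_div (@ger0_norm _ 2)// ler_pdivrMr// mul1r exprn_deriv_le2_half.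
Qed.

Lemma box_poly_diff_lipschitz i N z w (d : R) :
  (forall j, `|z j| <= 1/2) -> (forall j, `|w j| <= 1/2) ->
  (forall j, `|z j - w j| <= d) ->
  `|box_poly_diff i N z - box_poly_diff i N w| <= B * (n%:R * (4 * d)).
Proof.
move=> z2 w2 zw; rewrite -sumrB.
under eq_bigr do rewrite -mulrBr.
apply: sum_bound => k; apply: prod_lipschitz => j; [exact: (diff_factor_le1 _ (ex k))..|].
have d0 : 0 <= d by apply: le_trans (zw j).
case: ifP => _; last first.
  apply: le_trans (exprn_lipschitz_half _ _ _) _ => //.
  by have := zw j; lra.
rewrite -mulrBl normf_div (@ger0_norm _ 2)// ler_pdivrMr//.
by apply: le_trans (exprn_deriv_lipschitz_half _ _ _) _ => //; have := zw j; lra.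
Qed.

(** Only the variable [i] moves, so each monomial is a power of it times a fixed product of absolute
    value at most 1, and the one-variable Taylor bound applies term by term. The factor 2 undoes the
    halving in [box_poly_diff]. *)
Lemma box_poly_taylor i N z w :
  (forall j, `|z j| <= 1/2) -> (forall j, `|w j| <= 1/2) ->
  (forall j, j != i -> w j = z j) ->
  `|box_poly N w - box_poly N z - (w i - z i) * (2 * box_poly_diff i N z)| <=
    B * (4 * (w i - z i) ^+ 2).
Proof.
move=> z2 w2 wz; rewrite !mulr_sumr -!sumrB.
have -> : \sum_(k : ix N) (c (ex k) * \prod_j w j ^+ k j
      - c (ex k) * \prod_j z j ^+ k j
      - (w i - z i) * (2 * (c (ex k) * \prod_j
          (if j == i then (z j ^+ (k j).-1 *+ k j) / 2 else z j ^+ k j)))) =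
    \sum_(k : ix N) c (ex k) *
      ((w i ^+ k i - z i ^+ k i - (w i - z i) * (z i ^+ (k i).-1 *+ k i)) *
     \prod_(j | j != i) z j ^+ k j).
  have Pi (u : 'I_n -> R) : \prod_j u j = u i * \prod_(j | j != i) u j.
    exact: bigD1.
  apply: eq_bigr => k _.
  rewrite (Pi (fun j => w j ^+ k j)) (Pi (fun j => z j ^+ k j))
    (Pi (fun j => if _ then _ else _)) eqxx.
  have -> : \prod_(j | j != i) w j ^+ k j = \prod_(j | j != i) z j ^+ k j.
    by apply: eq_bigr => j /wz ->.
  have -> : \prod_(j | j != i) (if j == i then (z j ^+ (k j).-1 *+ k j) / 2
      else z j ^+ k j) = \prod_(j | j != i) z j ^+ k j.
    by apply: eq_bigr => j /negbTE ->.
  by field.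
apply: sum_bound => k; rewrite normrM -[leRHS]mulr1; apply: ler_pM => //.
  exact: exprn_taylor_half.
by apply: prod_le1 => j; exact: exprn_le1_half.
Qed.

End power_series_in_the_half_cube.

Section analytic_partial_derivative.
Context {R : realType}.

Lemma cvg_norm_le (u : nat -> R) (l d : R) :
  u N @[N --> \oo] --> l -> (forall N, `|u N| <= d) -> `|l| <= d.
Proof.
move=> ul ud; apply: (cvgr_to_le (cvg_norm ul)); exact: nearW.
Qed.

(** For fixed [h] the quotients [(v h N - u N) / h] converge in [N], and [D N] is within [C * h] of
    them for every [N]. So [D] is eventually within any [e] of the limit of a quotient, a centre
    that may depend on [e]: this is the Cauchy property. Summability of the differentiated series is
    thus never treated directly. *)
Lemma is_cvg_difference_quotients (u D : nat -> R) (v : R -> nat -> R) (h0 C : R) :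
  0 < h0 -> 0 <= C -> cvg (u N @[N --> \oo]) ->
  (forall h : R, 0 < h < h0 -> cvg (v h N @[N --> \oo])) ->
  (forall (h : R) N, 0 < h < h0 -> `|v h N - u N - h * D N| <= C * h ^+ 2) ->
  cvg (D N @[N --> \oo]).
Proof.
move=> h00 C0 cu cv H; apply/cauchy_cvgP; apply: cauchy_exP => e e0.
have [h hh0 Che] : exists2 h : R, 0 < h < h0 & C * h < e / 2.
  exists (Num.min (h0 / 2) (e / 2 / (C + 1) / 2)).
    by rewrite lt_min !divr_gt0 ?ltr_wpDl//= gt_min; apply/orP; left; lra.
  apply: (@le_lt_trans _ _ (C * (e / 2 / (C + 1) / 2))).
    by rewrite ler_wpM2l// ge_min lexx orbT.
  have C1 : 0 < C + 1 by lra.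
  rewrite mulrA ltr_pdivrMr// mulrA ltr_pdivrMr//; nra.
have h_gt0 : 0 < h by case/andP: hh0.
have /cvgrPdist_lt/(_ (e / 2)) cl : (v h N - u N) / h @[N --> \oo] -->
    (lim (v h N @[N --> \oo]) - lim (u N @[N --> \oo])) / h.
  by apply: cvgMl; apply: cvgB => //; exact: cv.
exists ((lim (v h N @[N --> \oo]) - lim (u N @[N --> \oo])) / h).
have e2 : 0 < e / 2 by rewrite divr_gt0.
have := cl e2; apply: filterS => N /=.
move: (_ / h) => l lN; rewrite /ball/=.
have : `|(v h N - u N) / h - D N| <= C * h.
  have -> : (v h N - u N) / h - D N = (v h N - u N - h * D N) / h.
    by field; rewrite gt_eqF.
  by rewrite normf_div (gtr0_norm h_gt0) ler_pdivrMr// -mulrA -expr2 H.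
move=> qD.
have -> : l - D N = (l - (v h N - u N) / h) + ((v h N - u N) / h - D N).
  by rewrite addrA subrK.
by apply: le_lt_trans (ler_normD _ _) _; lra.
Qed.

(* The Lipschitz and Taylor bounds of the box sums do not depend on their size,
   so they survive in the limit; no uniform convergence is needed. *)
Lemma analytic_at_partial n (f : 'rV[R]_n -> R) (p : 'rV[R]_n) (i : 'I_n) :
  analytic_at f p ->
  exists (r C : R) (g : 'rV[R]_n -> R), [/\ 0 < r,
    forall x x' d, ball p r x -> ball p r x' ->
      (forall j, `|x ord0 j - x' ord0 j| <= d) ->
      `|f x - f x'| <= C * d /\ `|g x - g x'| <= C * d
  & forall x x', ball p r x -> ball p r x' ->
      (forall j, j != i -> x' ord0 j = x ord0 j) ->
      `|f x' - f x - (x' ord0 i - x ord0 i) * g x|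
        <= C * (x' ord0 i - x ord0 i) ^+ 2].
Proof.
move=> [r [r0 [c Hc]]].
pose rho := r / 2.
have rho0 : 0 < rho by rewrite divr_gt0.
(* At this corner every [mono] is a power of [rho], so absolute convergence there bounds the sum of
   the rescaled coefficients [|c' k|]. *)
pose q : 'rV[R]_n := p + const_mx rho.
have qr : ball p r q.
  split => // i0 j; rewrite (ord1 i0) !mxE /ball/= opprD addrA subrr sub0r normrN gtr0_norm//.
  by rewrite /rho; lra.
have [[B0 HB0] _] := Hc q qr.
pose c' k := c k * \prod_(j < n) rho ^+ k j.
pose zz (x : 'rV[R]_n) j := (x ord0 j - p ord0 j) / rho.
have [B BB0 cB] : exists2 B, 0 <= B & forall N,
    \sum_(k : {ffun 'I_n -> 'I_N.+1}) `|c' (fun j => nat_of_ord (k j))| <= B.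
  exists `|B0| => // N; apply: le_trans (ler_norm _); apply: le_trans (HB0 N).
  rewrite /box_abs_sum; apply: ler_sum => k _; rewrite /c' /mono.
  rewrite (eq_bigr (fun j => (q ord0 j - p ord0 j) ^+ k j))// => j _.
  by rewrite !mxE addrAC subrr add0r.
have boxE x N : box_sum c p x N = box_poly c' N (zz x).
  apply: eq_bigr => k _; rewrite /c' /mono -mulrA -big_split/=.
  congr (_ * _); apply: eq_bigr => j _.
  by rewrite -exprMn /zz mulrC mulfVK// gt_eqF.
have cvgP x : ball p r x -> box_poly c' N (zz x) @[N --> \oo] --> f x.
  move=> /Hc[_]; rewrite (_ : box_sum c p x = fun N => box_poly c' N (zz x))//.
  exact/funext.
(* The bound 1/4 leaves room to move the coordinate [i] by [h < 1/4] inside the half cube, which the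
   difference quotients require. *)
have small x : ball p (rho / 4) x -> forall j, `|zz x j| < 1/4.
  move=> [_ xp] j; have := xp ord0 j; rewrite /ball/= distrC => H.
  rewrite /zz normf_div (gtr0_norm rho0) ltr_pdivrMr//; lra.
have half x : ball p (rho / 4) x -> forall j, `|zz x j| <= 1/2.
  by move=> /small H j; have := H j; lra.
have in_r x : ball p (rho / 4) x -> ball p r x.
  by apply: le_ball; rewrite /rho; lra.
have cvgD x : ball p (rho / 4) x -> cvg (box_poly_diff c' i N (zz x) @[N --> \oo]).
  move=> xp.
  pose x' h : 'rV[R]_n := x + (h * rho) *: delta_mx ord0 i.
  have zx' h j : zz (x' h) j = zz x j + h *+ (j == i).
    rewrite /zz /x' !mxE eqxx/= [X in _ + _ * X]mulrb; case: eqP => _.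
      by rewrite mulr1 mulr1n; field; rewrite gt_eqF.
    by rewrite mulr0 mulr0n !addr0.
  have x'h h : 0 < h < 1/4 -> forall j, `|zz (x' h) j| <= 1/2.
    move=> hh j; rewrite zx'; apply: le_trans (ler_normD _ _) _.
    have hn : `|h| = h by apply: gtr0_norm; case/andP: hh.
    by have := small _ xp j; rewrite normrMn hn; case: (j == i); rewrite ?mulr1n ?mulr0n; lra.
  have x'r h : 0 < h < 1/4 -> ball p r (x' h).
    move=> /x'h H; split => // i0 j; rewrite (ord1 i0) /ball/= distrC.
    have := H j; rewrite /zz normf_div (gtr0_norm rho0) ler_pdivrMr// /rho; lra.
  have quarter : 0 < 1/4 :> R by lra.
  have four : 0 <= B * 4 by rewrite mulr_ge0.
  have := @is_cvg_difference_quotients (fun N => box_poly c' N (zz x))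
    (fun N => 2 * box_poly_diff c' i N (zz x)) (fun h N => box_poly c' N (zz (x' h)))
    (1/4) (B * 4) quarter four.
  have H1 : cvg (box_poly c' N (zz x) @[N --> \oo]).
    by apply/cvg_ex; exists (f x); apply: cvgP; exact: in_r.
  move=> /(_ H1) H2.
  have : cvg (2 * box_poly_diff c' i N (zz x) @[N --> \oo]).
    apply: H2 => h.
      by move=> /x'r ?; apply/cvg_ex; exists (f (x' h)); exact: cvgP.
    move=> N hh; have := box_poly_taylor cB (i := i) N (half _ xp) (x'h _ hh).
    rewrite -mulrA (zx' h i) eqxx mulr1n (addrC (zz x i)) addrK; apply.
    by move=> j ji; rewrite zx' (negbTE ji) mulr0n addr0.
  move=> /cvg_ex[l /= Hl]; apply/cvg_ex; exists (2^-1 * l).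
  have : 2^-1 * (2 * box_poly_diff c' i N (zz x)) @[N --> \oo] --> 2^-1 * l.
    exact: cvgMr.
  by under eq_cvg do rewrite mulKf ?pnatr_eq0//.
(* The factor 2 undoes the halving in [box_poly_diff]; the division by [rho] is the chain rule for
   the rescaling [zz]. *)
pose g x := 2 * lim (box_poly_diff c' i N (zz x) @[N --> \oo]) / rho.
have cvgg x : ball p (rho / 4) x ->
    2 * box_poly_diff c' i N (zz x) / rho @[N --> \oo] --> g x.
  by move=> /cvgD H; apply: cvgMl; apply: cvgMr.
have nn : 0 <= B * n%:R by rewrite mulr_ge0.
exists (rho / 4), (B * n%:R * 2 / rho + B * n%:R * 8 / rho ^+ 2 + B * 4 / rho ^+ 2), g.
have t1 : 0 <= B * n%:R * 2 / rho by rewrite divr_ge0 ?(ltW rho0)// mulr_ge0.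
have t2 : 0 <= B * n%:R * 8 / rho ^+ 2 by rewrite divr_ge0 ?sqr_ge0// mulr_ge0.
have t3 : 0 <= B * 4 / rho ^+ 2 by rewrite divr_ge0 ?sqr_ge0// mulr_ge0.
split; first by rewrite divr_gt0.
- move=> x x' d xp x'p xx'.
  have zd j : `|zz x j - zz x' j| <= d / rho.
    rewrite /zz -mulrBl normf_div (gtr0_norm rho0) ler_pM2r ?invr_gt0//.
    by rewrite opprB addrA subrK.
  have d0 : 0 <= d by apply: le_trans (xx' i).
  split.
    apply: (@cvg_norm_le (fun N => box_poly c' N (zz x) - box_poly c' N (zz x'))).
      by apply: cvgB; apply: cvgP; exact: in_r.
    move=> N; apply: le_trans (box_poly_lipschitz cB N (half _ xp) (half _ x'p) zd) _.
    rewrite (_ : _ * (_ * _) = B * n%:R * 2 / rho * d); last by ring.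
    by rewrite ler_wpM2r//; lra.
  apply: (@cvg_norm_le (fun N => 2 * box_poly_diff c' i N (zz x) / rho
      - 2 * box_poly_diff c' i N (zz x') / rho)).
    by apply: cvgB; exact: cvgg.
  move=> N; rewrite -mulrBl -mulrBr normf_div (gtr0_norm rho0) normrM gtr0_norm//.
  have := box_poly_diff_lipschitz cB i N (half _ xp) (half _ x'p) zd.
  move: `|_| => A HA; apply: (@le_trans _ _ (B * n%:R * 8 / rho ^+ 2 * d)).
    rewrite (_ : _ * d = 2 * (B * (n%:R * (4 * (d / rho)))) / rho); last first.
      by field; rewrite gt_eqF.
    by rewrite ler_pM2r ?invr_gt0// ler_pM2l.
  by rewrite ler_wpM2r//; lra.
- move=> x x' xp x'p xx'.
  apply: (@cvg_norm_le (fun N => box_poly c' N (zz x') - box_poly c' N (zz x)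
      - (x' ord0 i - x ord0 i) * (2 * box_poly_diff c' i N (zz x) / rho))).
    apply: cvgB; first by apply: cvgB; apply: cvgP; exact: in_r.
    by apply: cvgMr; exact: cvgg.
  move=> N; have := box_poly_taylor cB (i := i) N (half _ xp) (half _ x'p) _.
  have -> : zz x' i - zz x i = (x' ord0 i - x ord0 i) / rho.
    by rewrite /zz -mulrBl opprB addrA subrK.
  move=> H; apply: le_trans (_ : _ <= B * (4 * ((x' ord0 i - x ord0 i) / rho) ^+ 2)) _.
    rewrite (_ : _ * (_ / rho) = (x' ord0 i - x ord0 i) / rho *
      (2 * box_poly_diff c' i N (zz x))); last by ring.
    by apply: H => j ji; rewrite /zz xx'.
  rewrite (_ : B * _ = B * 4 / rho ^+ 2 * (x' ord0 i - x ord0 i) ^+ 2); last first.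
    by field; rewrite gt_eqF.
  by rewrite ler_wpM2r ?sqr_ge0//; lra.
Qed.

End analytic_partial_derivative.

(** * The integral of [U_y] along the trajectory *)

(** Here [A] and [A0] are [U_y] at [x] and at [sg], [t = V(sg) / V(x)], [rho = x / sg], [w = - y']
    and [zs = y / sg]. One has [|t * rho - 1| <= eta1 + 2 * (rho - 1)], and [kap <= 1/2] gives [2 *
    (rho - 1) <= 4 * (rho - 1) * (1 - kap)]; replacing [kap * rho * w] by the smaller [zs] produces
    an exact derivative. *)
Lemma bracket_pointwise (R : realType) (A A0 t rho zs w L eta eta1 kap : R) :
  0 <= w -> 1 <= rho -> 0 <= L -> eta1 <= 1 -> kap <= 1 / 2 ->
  `|t - 1| <= eta1 -> `|A| <= L -> `|A - A0| <= eta -> zs <= kap * rho * w ->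
  A * w * (t * rho) <= A0 * w + (eta + L * eta1) * w
    + 4 * L * ((rho - 1 + kap) * w - zs).
Proof.
move=> w0 rho1 L0 eta1_le1 kap_le; rewrite !ler_norml.
move=> /andP[t1 t2] /andP[A1 A2] /andP[_ Av] zsw.
have j1 : 0 <= rho * (1 + eta1 - t) by rewrite mulr_ge0//; lra.
have j2 : 0 <= rho * (t - 1 + eta1) by rewrite mulr_ge0//; lra.
have j3 : 0 <= (rho - 1) * (1 - eta1) by rewrite mulr_ge0//; lra.
have k1 : A * (t * rho - 1) <= L * (eta1 + 2 * (rho - 1)).
  apply: le_trans (ler_norm _) _; rewrite normrM; apply: ler_pM => //.
    by rewrite ler_norml A1.
  by rewrite ler_norml; apply/andP; split; lra.
have k2 : 0 <= L * ((rho - 1) * (1 - 2 * kap)).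
  by rewrite mulr_ge0// mulr_ge0//; lra.
have key : A * (t * rho) <=
    A0 + (eta + L * eta1) + 4 * L * (rho - 1 + kap - kap * rho) by lra.
have k3 : 0 <= 4 * L * (kap * rho * w - zs).
  by rewrite mulr_ge0 ?mulr_ge0 ?subr_ge0.
by have := ler_wpM2r w0 key; lra.
Qed.

Section bracket_estimate.
Context {R : realType}.
Notation leb := (@lebesgue_measure R).
Variables (m sg d1 : R) (E g h v : R -> R) (W Wy : R -> R -> R).
Variables (v0 v1 L eta eta1 kap : R).
Hypotheses (m_sg : m < sg) (sg0 : 0 < sg) (sg_d1 : sg < d1) (d1_1 : d1 <= 1).
Hypothesis dE : forall x, m < x -> is_derive x 1 E (g x).
Hypothesis gE : forall x, m < x -> g x = v x * h x / x.
Hypothesis h_gt0 : forall x, m < x -> 0 < h x.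
Hypotheses (v0_gt0 : 0 < v0) (L_ge0 : 0 <= L) (eta1_ge0 : 0 <= eta1) (eta_ge0 : 0 <= eta).
Hypotheses (eta1_le1 : eta1 <= 1) (kap_ge0 : 0 <= kap) (kap_le : kap <= 1 / 2).
Hypothesis v_bound : forall x, sg <= x <= 1 -> v0 <= v x <= v1.
Hypothesis h_large : forall x, sg <= x <= d1 -> 1 <= kap * (v0 * h x).
Hypothesis v_var : forall x, sg <= x <= d1 -> `|v sg - v x| <= eta1 * v0.
Hypothesis dW : forall y : R, 0 < y -> y <= 1 -> is_derive y 1 (W sg) (Wy sg y).
Hypothesis Wy_bound : forall x y : R, sg <= x <= 1 -> 0 < y -> y <= 1 -> `|Wy x y| <= L.
Hypothesis Wy_var : forall x y : R, sg <= x <= d1 -> 0 < y -> y <= 1 ->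
  `|Wy x y - Wy sg y| <= eta.

Let Z x := expR (E sg - E x).
Let w x := Z x * g x.
Let J x := Wy x (Z x) * (Z x * g sg) * h x.
Hypothesis cJ : forall x, sg <= x <= 1 -> {for x, continuous J}.

Let g_ge0 x : sg <= x -> x <= 1 -> 0 <= g x.
Proof.
move=> sx x1; rewrite gE ?(lt_le_trans m_sg)//.
have /andP[vx _] := v_bound (introT andP (conj sx x1)).
by rewrite divr_ge0 ?mulr_ge0 ?(ltW (h_gt0 (lt_le_trans m_sg sx)))
  ?(le_trans (ltW v0_gt0) vx) ?(le_trans (ltW sg0) sx).
Qed.

Let Z_gt0 x : 0 < Z x.
Proof. exact: expR_gt0. Qed.

Let Zsg : Z sg = 1.
Proof. by rewrite /Z subrr expR0. Qed.

Let dZ x : sg <= x -> is_derive x 1 Z (- w x).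
Proof.
move=> sx; have H := dE (lt_le_trans m_sg sx).
have D : is_derive x 1 (fun x => E sg - E x) (- g x).
  by apply: is_derive_eq; rewrite add0r mul1r.
have := @is_derive1_comp R expR _ x _ _ (is_derive_expR _) D.
by rewrite mulrN.
Qed.

Let Z_le1 x : sg <= x -> x <= 1 -> Z x <= 1.
Proof.
move=> sx x1; rewrite -Zsg -subr_ge0.
have [||c + Hc] := @MVT_segment R Z (fun x => - w x) sg x sx.
- by move=> z; rewrite in_itv/= => /andP[/ltW sz _]; exact: dZ.
- apply: continuous_in_subspaceT => z /set_mem/=; rewrite in_itv/= => /andP[sz _].
  exact: is_derive_continuous (dZ sz).
rewrite in_itv/= => /andP[sc cx].
rewrite -opprB oppr_ge0 Hc mulNr oppr_le0 mulr_ge0 ?subr_ge0//.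
by rewrite mulr_ge0 ?(ltW (Z_gt0 _))// g_ge0// (le_trans cx).
Qed.

(** The ratio [g sg / g x] converts the derivative in the starting point into [w = - y']. The factor
    [h x] cancels, leaving [h sg] in front and the weight [x V(sg) / (sg V(x))]. *)
Let J_E x : sg <= x -> x <= 1 ->
  J x = h sg * (Wy x (Z x) * w x * (v sg / v x * (x / sg))).
Proof.
move=> sx x1; have /andP[vx _] := v_bound (introT andP (conj sx x1)).
have vx0 : 0 < v x by exact: lt_le_trans vx.
have x0 : 0 < x by exact: lt_le_trans sx.
rewrite /J /w (gE m_sg) (gE (lt_le_trans m_sg sx)); field.
by rewrite !gt_eqF.
Qed.

(** The slowness of [x] relative to [y], namely [y <= kap * x * (- y')], divided by [sg]. *)
Let Z_le_w x : sg <= x <= d1 -> Z x / sg <= kap * (x / sg) * w x.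
Proof.
move=> /andP[sx xd]; have x1 := le_trans xd d1_1.
have /andP[vx _] := v_bound (introT andP (conj sx x1)).
have vx0 : 0 < v x by exact: lt_le_trans vx.
have x0 : 0 < x by exact: lt_le_trans sx.
have hx0 := h_gt0 (lt_le_trans m_sg sx).
have -> : kap * (x / sg) * w x = Z x / sg * (kap * (v x * h x)).
  by rewrite /w (gE (lt_le_trans m_sg sx)); field; rewrite !gt_eqF.
rewrite ler_peMr ?divr_ge0 ?(ltW sg0) ?(ltW (Z_gt0 _))//.
apply: le_trans (h_large (introT andP (conj sx xd))) _.
by rewrite ler_wpM2l// ler_wpM2r// ltW.
Qed.

(* Because [x^2 y(x)] is nonincreasing on [sg, d1]. *)
Lemma bracket_trajectory_bound : expR (E sg - E d1) <= sg ^+ 2 / d1 ^+ 2.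
Proof.
have d10 : 0 < d1 by exact: lt_trans sg_d1.
rewrite ler_pdivlMr ?exprn_gt0// -subr_ge0.
have := @Rintegral_le_of_derive R (fun=> 0) (fun x => - (Z x * x ^+ 2))
  (fun x => w x * x ^+ 2 - Z x * (2 * x)) sg d1 (ltW sg_d1).
rewrite Rintegral_cst ?measurable_itv// mul0r Zsg mul1r opprK addrC.
apply.
- by move=> x _; exact: cvg_cst.
- move=> x /andP[sx _]; have D := dZ sx.
  apply: is_derive_eq.
  by rewrite /GRing.scale /=; ring.
- move=> x /andP[/ltW sx /ltW xd]; have x1 := le_trans xd d1_1.
  have x0 : 0 < x by exact: lt_le_trans sx.
  have sxd : sg <= x <= d1 by rewrite sx.
  have := Z_le_w sxd.
  have -> : kap * (x / sg) * w x = kap * (x * w x) / sg by ring.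
  rewrite ler_pM2r ?invr_gt0// => H /=.
  have w0 : 0 <= w x by rewrite mulr_ge0 ?(ltW (Z_gt0 _)) ?g_ge0.
  have xw0 : 0 <= x * w x by rewrite mulr_ge0// ltW.
  (* With [kap <= 1/2] one gets [2 * y <= x * (- y')], which is where the exponent 2 comes from. *)
  have k1 := ler_wpM2r xw0 kap_le.
  have -> : w x * x ^+ 2 - Z x * (2 * x) = x * (x * w x - 2 * Z x) by ring.
  by rewrite mulr_ge0 ?(ltW x0)// ; lra.
Qed.

(* On [sg, d1] the integrand is dominated by the derivative of
   [- W sg y - (eta + L eta1) y - 4 L (x / sg - 1 + kap) y], where the last term
   absorbs the growth of [x / sg]; on [d1, 1] it is dominated by a multiple of
   [- y'], and [y(d1)] is of order [sg^2]. *)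
Lemma bracket_integral_bound :
  \int[leb]_(x in `[sg, 1]) (Wy x (expR (E sg - E x)) *
      (expR (E sg - E x) * g sg) * h x) <=
  h sg * (W sg 1 - W sg (expR (E sg - E d1)) + (eta + L * eta1 + 4 * L * kap)
          + L * v1 / (v0 * sg) * expR (E sg - E d1)).
Proof.
rewrite (@Rintegral_segment_split _ J sg d1 1) ?(ltW sg_d1)//.
rewrite mulrDr; apply: lerD.
- apply: le_trans (@Rintegral_le_of_derive R J
    (fun x => h sg * (- W sg (Z x) - (eta + L * eta1) * Z x
              - 4 * L * (x / sg - 1 + kap) * Z x))
    (fun x => h sg * (Wy sg (Z x) * w x + (eta + L * eta1) * w x
              + 4 * L * ((x / sg - 1 + kap) * w x - Z x / sg)))
    sg d1 (ltW sg_d1) _ _ _) _.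
  + by move=> x /andP[sx xd]; apply: cJ; rewrite sx (le_trans xd).
  + move=> x /andP[sx xd]; have D := dZ sx.
    have DW := @is_derive1_comp R (W sg) Z x _ _ (dW (Z_gt0 x) (Z_le1 sx (le_trans xd d1_1))) D.
    rewrite /comp in DW.
    apply: is_derive_eq.
    by rewrite /GRing.scale /= ; ring.
  + move=> x /andP[/ltW sx /ltW xd]; have x1 := le_trans xd d1_1.
    rewrite J_E// ler_wpM2l ?(ltW (h_gt0 m_sg))//.
    have sxd : sg <= x <= d1 by rewrite sx.
    have sx1 : sg <= x <= 1 by rewrite sx.
    have /andP[vx _] := v_bound sx1.
    have vx0 : 0 < v x by exact: lt_le_trans vx.
    have := Z_le_w sxd.
    have w0 : 0 <= w x by rewrite mulr_ge0 ?(ltW (Z_gt0 _)) ?g_ge0.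
    have := Wy_var sxd (Z_gt0 x) (Z_le1 sx x1).
    have := Wy_bound sx1 (Z_gt0 x) (Z_le1 sx x1).
    have rho1 : 1 <= x / sg by rewrite ler_pdivlMr// mul1r.
    have t1 : `|v sg / v x - 1| <= eta1.
      have -> : v sg / v x - 1 = (v sg - v x) / v x by field; rewrite gt_eqF.
      rewrite normf_div (gtr0_norm vx0) ler_pdivrMr//.
      by apply: le_trans (v_var sxd) _; rewrite ler_wpM2l.
    move=> Wyx Wyv Zw; exact: bracket_pointwise.
  (* At [sg] the difference [x / sg - 1] vanishes and [Z] is 1, so the absorbing term costs only
     [4 * L * kap]. Its value and that of the [eta] term at [d1] have a favourable sign and are
     dropped. *)
  rewrite -mulrBr ler_wpM2l ?(ltW (h_gt0 m_sg))//.
  rewrite Zsg divff ?gt_eqF//.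
  have k1 : 0 <= (eta + L * eta1) * Z d1.
    by rewrite mulr_ge0 ?addr_ge0 ?mulr_ge0 ?(ltW (Z_gt0 _)).
  have k2 : 0 <= 4 * L * (d1 / sg - 1 + kap) * Z d1.
    rewrite !mulr_ge0 ?(ltW (Z_gt0 _))// addr_ge0// subr_ge0 ler_pdivlMr// mul1r.
    exact: ltW.
  rewrite -/(Z d1); lra.
- rewrite -/(Z d1).
  have C0 : 0 <= L * v1 / (v0 * sg).
    have /andP[a1 a2] : v0 <= v sg <= v1.
      by apply: v_bound; rewrite lexx (le_trans (ltW sg_d1)).
    rewrite divr_ge0 ?mulr_ge0 ?(ltW sg0) ?(ltW v0_gt0)//.
    by apply: le_trans a2; apply: le_trans a1; exact: ltW.
  apply: le_trans (@Rintegral_le_of_derive R J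
    (fun x => - (h sg * (L * v1 / (v0 * sg))) * Z x)
    (fun x => h sg * (L * v1 / (v0 * sg)) * w x)
    d1 1 d1_1 _ _ _) _.
  + by move=> x /andP[dx xd]; apply: cJ; rewrite xd (le_trans (ltW sg_d1)).
  + move=> x /andP[dx x1]; have D := dZ (le_trans (ltW sg_d1) dx).
    by apply: is_derive_eq; rewrite /GRing.scale /= ; ring.
  + move=> x /andP[/ltW dx /ltW x1]; have sx := le_trans (ltW sg_d1) dx.
    rewrite J_E// -[leRHS]mulrA ler_wpM2l ?(ltW (h_gt0 m_sg))//.
    have sx1 : sg <= x <= 1 by rewrite sx.
    have /andP[vx vx1] := v_bound sx1.
    have vx0 : 0 < v x by exact: lt_le_trans vx.
    have x0 : 0 < x by exact: lt_le_trans sx.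
    have /andP[a1 a2] : v0 <= v sg <= v1.
      by apply: v_bound; rewrite lexx (le_trans (ltW sg_d1)).
    have vs0 : 0 < v sg by exact: lt_le_trans a1.
    have w0 : 0 <= w x by rewrite mulr_ge0 ?(ltW (Z_gt0 _)) ?g_ge0.
    rewrite mulrAC ler_wpM2r//.
    apply: le_trans (ler_norm _) _; rewrite normrM.
    have -> : L * v1 / (v0 * sg) = L * (v1 / v0 * (1 / sg)) by field; rewrite !gt_eqF.
    apply: ler_pM => //; first exact: (Wy_bound sx1 (Z_gt0 x) (Z_le1 sx x1)).
    rewrite ger0_norm; last by rewrite !mulr_ge0 ?invr_ge0 ?ltW.
    by rewrite !ler_pM ?divr_ge0 ?mulr_ge0 ?invr_ge0 ?(ltW vx0) ?(ltW sg0)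
      ?(ltW vs0) ?(ltW x0) ?lef_pV2 ?posrE.
  move: C0; move: (L * v1 / _) => C C0.
  have : 0 <= h sg * C * Z 1 by rewrite mulr_ge0 ?mulr_ge0 ?(ltW (Z_gt0 _)) ?(ltW (h_gt0 m_sg)).
  by move: (h sg) (Z 1) (Z d1) => hs Z1 Zd; lra.
Qed.

End bracket_estimate.

(** * Compactness, and joint continuity from analyticity *)

Section compactness.
Context {R : realType}.

Lemma compact_positive_lower_bound (T : topologicalType) (S : set T) (f : T -> R) :
  compact S -> (forall q, S q -> {for q, continuous f}) ->
  (forall q, S q -> 0 < f q) ->
  exists2 l : R, 0 < l & forall q, S q -> l <= f q.
Proof.
move=> /(compact_near_coveringP _).1 cpt cf f0.
have := cpt _ (0^'+ : set_system R) (fun l q => l <= f q) _.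
case=> [q Sq|d /= d0 Hd].
  near=> q' l => /=; apply: (@le_trans _ _ (f q / 2)).
    by near: l; apply: nbhs_right_le; rewrite divr_gt0// f0.
  near: q'; apply: (cvgr_ge _ (cf _ Sq)).
  by have := f0 _ Sq; lra.
exists (d / 2); first by rewrite divr_gt0.
apply: Hd; rewrite /= ?sub0r ?normrN ?gtr0_norm ?divr_gt0//; lra.
Unshelve. all: by end_near. Qed.

(** Near [q], both [f x q'] and [f x0 q'] are within [e / 2] of the same value [f x0 q]; compactness
    then gives one neighbourhood of [x0] for all of [S]. *)
Lemma compact_equicontinuous (X T : topologicalType) (S : set T) (x0 : X)
    (f : X -> T -> R) (e : R) :
  0 < e -> compact S ->
  (forall q, S q -> {for (x0, q), continuous (fun p => f p.1 p.2)}) ->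
  \forall x \near x0, forall q, S q -> `|f x q - f x0 q| <= e.
Proof.
move=> e0 /(compact_near_coveringP _).1 cpt cf.
apply: cpt => q Sq.
have e2 : 0 < e / 2 by rewrite divr_gt0.
have := cf _ Sq => /cvgrPdist_lt/(_ _ e2) [[A B] [/= nA nB] AB].
exists (B, A); first by split.
move=> [q' x] [/= Bq Ax].
have H1 := AB (x, q') (conj Ax Bq).
have H2 := AB (x0, q') (conj (nbhs_singleton nA) Bq).
rewrite /= in H1 H2.
have -> : f x q' - f x0 q' = (f x0 q - f x0 q') - (f x0 q - f x q') by ring.
by apply: le_trans (ler_normB _ _) _; lra.
Qed.

End compactness.

Section packed_functions.
Context {R : realType} {alpha : nat}.
Implicit Types (a : 'rV[R]_alpha) (x y : R).

Definition pt3 a x y : 'rV[R]_(2 + alpha) :=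
  row_mx (\row_(j < 2) if j == ord0 then x else y) a.
Definition pt2 a x : 'rV[R]_(1 + alpha) := row_mx (\row_(j < 1) x) a.

Let pack3E (U : 'rV[R]_alpha -> R -> R -> R) a x y : pack3 U (pt3 a x y) = U a x y.
Proof. by rewrite /pack3 /pt3 row_mxKr row_mxKl !mxE. Qed.

Let pack2E (V : 'rV[R]_alpha -> R -> R) a x : pack2 V (pt2 a x) = V a x.
Proof. by rewrite /pack2 /pt2 row_mxKr row_mxKl !mxE. Qed.

Lemma cube_times3 (A : set 'rV[R]_alpha) a x y :
  A a -> -1 <= x <= 1 -> -1 <= y <= 1 -> cube_times 2 A (pt3 a x y).
Proof.
move=> Aa x1 y1; split; last by rewrite row_mxKr.
by move=> i; rewrite row_mxKl mxE ler_norml; case: ifP.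
Qed.

Lemma cube_times2 (A : set 'rV[R]_alpha) a x :
  A a -> -1 <= x <= 1 -> cube_times 1 A (pt2 a x).
Proof.
move=> Aa x1; split; last by rewrite row_mxKr.
by move=> i; rewrite row_mxKl mxE ler_norml.
Qed.

Let pt3_ind (P : R -> R -> Prop) a x y a' x' y' :
  P x x' -> P y y' -> (forall j, P (a ord0 j) (a' ord0 j)) ->
  forall j, P (pt3 a x y ord0 j) (pt3 a' x' y' ord0 j).
Proof.
move=> Px Py Pa j; rewrite -(fintype.splitK j); case: (fintype.split j) => k /=.
  by rewrite !row_mxEl !mxE; case: ifP.
by rewrite !row_mxEr.
Qed.

Let pt2_ind (P : R -> R -> Prop) a x a' x' :
  P x x' -> (forall j, P (a ord0 j) (a' ord0 j)) ->
  forall j, P (pt2 a x ord0 j) (pt2 a' x' ord0 j).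
Proof.
move=> Px Pa j; rewrite -(fintype.splitK j); case: (fintype.split j) => k /=.
  by rewrite !row_mxEl !mxE.
by rewrite !row_mxEr.
Qed.

Let lipschitz_continuous (T : pseudoMetricType R) (f : T -> R) (q : T) (r C : R) :
  0 < r -> (forall q' d, d <= r -> ball q d q' -> `|f q - f q'| <= C * d) ->
  {for q, continuous f}.
Proof.
move=> r0 H; apply/cvgrPdist_le => e e0.
pose d := Num.min r (e / (`|C| + 1)).
have C1 : 0 < `|C| + 1 by rewrite ltr_wpDl.
have d0 : 0 < d by rewrite lt_min r0 divr_gt0.
apply/nbhs_ballP; exists d => //= q' qq'.
have := H q' d; rewrite ge_min lexx => /(_ isT qq')/le_trans; apply.
apply: (@le_trans _ _ ((`|C| + 1) * d)).
  by rewrite ler_pM2r// ler_wpDr// ler_norm.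
by rewrite -ler_pdivlMl// mulrC ge_min lexx orbT.
Qed.

Lemma pack2_continuous (V : 'rV[R]_alpha -> R -> R) (A : set 'rV[R]_alpha) a x :
  analytic_on (cube_times 1 A) (pack2 V) -> A a -> -1 <= x <= 1 ->
  {for (a, x), continuous (fun q : 'rV[R]_alpha * R => V q.1 q.2)}.
Proof.
move=> /(_ _ (cube_times2 _ _)) H Aa x1.
have [r [C [g [r0 Lip _]]]] := analytic_at_partial (lshift alpha ord0) (H _ _ Aa x1).
apply: (@lipschitz_continuous _ _ _ r C r0) => -[a' x'] d dr [/= [d0 aa'] xx'].
rewrite -!pack2E; have [] := Lip (pt2 a x) (pt2 a' x') d.
- exact: ballxx.
- split=> // i j; rewrite (ord1 i).
  apply: (@pt2_ind (fun u v => ball u r v)); first exact: le_ball xx'.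
  by move=> k; apply: le_ball (aa' _ _).
- apply: (@pt2_ind (fun u v => `|u - v| <= d)); first exact: ltW.
  by move=> k; apply/ltW/(aa' ord0).
- by [].
Qed.

(** All that the estimates take from the analyticity of [U]. The first clause makes the total
    function [derive1] a genuine derivative, so that its continuity has a meaning. *)
Definition regular3 (U : 'rV[R]_alpha -> R -> R -> R) a x y :=
  [/\ is_derive y 1 (U a x) ((U a x)^`()%classic y),
   {for (a, x, y), continuous (fun q : 'rV[R]_alpha * R * R => U q.1.1 q.1.2 q.2)}
   & {for (a, x, y), continuous
       (fun q : 'rV[R]_alpha * R * R => (U q.1.1 q.1.2)^`()%classic q.2)}].

(** Regularity holds on a full neighbourhood, also where it leaves the cube: analyticity at a
    boundary point such as [y = 1] includes a ball around it. *)
Lemma pack3_regular (U : 'rV[R]_alpha -> R -> R -> R) (A : set 'rV[R]_alpha) a x y :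
  analytic_on (cube_times 2 A) (pack3 U) -> A a -> -1 <= x <= 1 -> -1 <= y <= 1 ->
  \forall q \near (a, x, y), regular3 U q.1.1 q.1.2 q.2.
Proof.
move=> /(_ _ (cube_times3 _ _ _)) H Aa x1 y1.
pose i0 : 'I_(2 + alpha) := lshift alpha ord_max.
have [r [C [g [r0 Lip Tay]]]] := analytic_at_partial i0 (H _ _ _ Aa x1 y1).
have pt_i a1 x2 y2 : pt3 a1 x2 y2 ord0 i0 = y2 by rewrite /pt3 row_mxEl mxE.
have inball a1 x2 y2 : ball (a, x, y) r (a1, x2, y2) -> ball (pt3 a x y) r (pt3 a1 x2 y2).
  move=> [/= [/= [d0 aa'] xx'] yy']; split => // i j; rewrite (ord1 i).
  by apply: (@pt3_ind (fun u v => ball u r v)).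
have der a1 x2 y2 : ball (a, x, y) r (a1, x2, y2) ->
    is_derive y2 1 (U a1 x2) (g (pt3 a1 x2 y2)).
  move=> b1; apply: is_derive_little => e e0.
  have [b2 b3] := b1.
  have C1 : 0 < `|C| + 1 by rewrite ltr_wpDl.
  near=> y3.
  have b4 : ball (a, x, y) r (a1, x2, y3).
    split => //=; near: y3; apply: open_nbhs_nbhs; split => //; exact: ball_open.
  have := Tay _ _ (inball _ _ _ b1) (inball _ _ _ b4).
  rewrite !pack3E !pt_i [_ * g _]mulrC => /(_ _)/le_trans; apply.
    move=> j; rewrite -(fintype.splitK j); case: (fintype.split j) => k /=;
      last by rewrite /pt3 !row_mxEr.
    rewrite /pt3 !row_mxEl !mxE; case: ifP => // k0 /eqP []; congr lshift.
    by apply/val_inj; case: k k0 => -[|[|]].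
  rewrite -(real_normK (num_real (y3 - y2))) expr2 mulrA ler_wpM2r//.
  apply: (@le_trans _ _ ((`|C| + 1) * `|y3 - y2|)).
    by rewrite ler_wpM2r// ler_wpDr// ler_norm.
  rewrite -ler_pdivlMl// mulrC distrC; near: y3.
  by exists (e / (`|C| + 1)); [exact: divr_gt0|move=> z /= /ltW].
have opn : open (ball (a, x, y) r) by exact: ball_open.
have : \forall q \near (a, x, y), ball (a, x, y) r q by exact: nbhsx_ballx.
apply: filterS => -[[a1 x2] y2] /= b1.
have /nbhs_ballP[r' /= r'0 Hr'] := opn _ b1.
(* So far [g] is only a limit of box sums; identifying it with the derivative throughout the ball
   carries its Lipschitz bound over to [U_y]. *)
have gE q : ball (a, x, y) r q -> (U q.1.1 q.1.2)^`()%classic q.2 = g (pt3 q.1.1 q.1.2 q.2).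
  by case: q => [[a3 x3] y3] /der [_ +]; rewrite derive1E.
have lip q' d : d <= r' -> ball (a1, x2, y2) d q' ->
    ball (a, x, y) r q' /\
    `|U a1 x2 y2 - U q'.1.1 q'.1.2 q'.2| <= C * d /\
    `|g (pt3 a1 x2 y2) - g (pt3 q'.1.1 q'.1.2 q'.2)| <= C * d.
  case: q' => [[a3 x3] y3] dr' /= b2.
  have b3 : ball (a, x, y) r (a3, x3, y3) by apply: Hr'; exact: le_ball b2.
  split => //; rewrite -!pack3E; apply: Lip; [exact: inball..|].
  have [/= [/= [d0 aa'] xx'] yy'] := b2.
  apply: (@pt3_ind (fun u v => `|u - v| <= d)); [exact: ltW..|].
  by move=> k; apply/ltW/(aa' ord0).
split.
- by rewrite (gE (a1, x2, y2))//; exact: der.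
- apply: (@lipschitz_continuous _ _ _ r' C r'0) => q' d dr' b2.
  by have [_ []] := lip q' d dr' b2.
- apply: (@lipschitz_continuous _ _ _ r' C r'0) => q' d dr' b2.
  have [b3 [_ +]] := lip q' d dr' b2.
  by rewrite -(gE (a1, x2, y2))// -gE.
Unshelve. all: by end_near. Qed.

End packed_functions.

Lemma continuous_comp3 (T A X Y W : topologicalType) (fa : T -> A) (fx : T -> X)
    (fy : T -> Y) (F : A -> X -> Y -> W) (t : T) :
  {for t, continuous fa} -> {for t, continuous fx} -> {for t, continuous fy} ->
  {for (fa t, fx t, fy t), continuous (fun q => F q.1.1 q.1.2 q.2)} ->
  {for t, continuous (fun t => F (fa t) (fx t) (fy t))}.
Proof.
move=> ca cx cy cF.
apply: (@continuous_comp2 _ _ _ _ (fun t => (fa t, fx t)) fy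
  (fun q y => F q.1 q.2 y)) => //.
exact: (cvg_pair ca cx).
Qed.

(** * The singular point, and the derivative of the Dulac time at fixed parameters *)

Section theta_properties.
Context {R : realType}.
Implicit Types (eps x d : R).

Lemma theta_ge0 (mu : nat) eps : 0 <= theta mu eps.
Proof. by rewrite /theta; case: ifP => // _; exact: powR_ge0. Qed.

Lemma theta_expn (mu : nat) eps : (0 < mu)%N -> 0 < eps -> theta mu eps ^+ mu = eps.
Proof.
move=> mu0 eps0; rewrite /theta leNgt eps0/= -powR_mulrn ?powR_ge0// -powRrM.
by rewrite mulVf ?powRr1 ?(ltW eps0)// pnatr_eq0 -lt0n.
Qed.

Lemma theta_lt_gt0 (mu : nat) eps x : (0 < mu)%N -> theta mu eps < x -> 0 < x ^+ mu - eps.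
Proof.
move=> mu0 tx; have x0 : 0 < x by exact: le_lt_trans (theta_ge0 _ _) tx.
rewrite subr_gt0; have [eps0|eps0] := leP eps 0.
  by apply: le_lt_trans eps0 _; exact: exprn_gt0.
by rewrite -{1}(theta_expn mu0 eps0) ltrXn2r ?theta_ge0// -?lt0n// ltW.
Qed.

Lemma theta_small (mu : nat) eps d : (0 < mu)%N -> 0 < d -> eps < d ^+ mu ->
  theta mu eps < d.
Proof.
move=> mu0 d0 epsd; have [eps0|eps0] := leP eps 0; first by rewrite /theta eps0.
rewrite ltNge; apply/negP => dt; move: epsd; apply/negP; rewrite -leNgt.
by rewrite -{1}(theta_expn mu0 eps0) lerXn2r// nnegrE ?theta_ge0// ltW.
Qed.

End theta_properties.

Section dulac_time_derivative.
Context {R : realType} {alpha : nat}.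
Notation leb := (@lebesgue_measure R).
Variables (U : 'rV[R]_alpha -> R -> R -> R) (V : 'rV[R]_alpha -> R -> R).
Variables (mu : nat) (eps : R) (a : 'rV[R]_alpha) (s r d1 : R).
Variables (v0 v1 L eta eta1 kap : R).
Let sg := s + theta mu eps.
Notation Uy x y := ((U a x)^`()%classic y).
Hypotheses (mu_gt0 : (0 < mu)%N) (s0 : 0 < s) (r0 : 0 < r).
Hypotheses (sg_d1 : sg < d1) (d1_1 : d1 <= 1).
Hypothesis cV : forall x, 0 <= x <= 1 -> {for x, continuous (V a)}.
Hypothesis rU : forall x y, 0 <= x <= 1 -> 0 < y -> y < 1 + r -> regular3 U a x y.
Hypotheses (v0_gt0 : 0 < v0) (L_ge0 : 0 <= L) (eta1_ge0 : 0 <= eta1) (eta_ge0 : 0 <= eta).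
Hypotheses (eta1_le1 : eta1 <= 1) (kap_ge0 : 0 <= kap) (kap_le : kap <= 1 / 2).
Hypothesis V_bound : forall x, 0 <= x <= 1 -> v0 <= V a x <= v1.
Hypothesis q_small : forall x, sg <= x <= d1 -> x ^+ mu - eps <= kap * v0.
Hypothesis V_var : forall x, 0 <= x <= d1 -> `|V a sg - V a x| <= eta1 * v0.
Hypothesis Uy_bound : forall x y, 0 <= x <= 1 -> 0 <= y <= 1 -> `|Uy x y| <= L.
Hypothesis Uy_var : forall x y, 0 <= x <= d1 -> 0 <= y <= 1 -> `|Uy x y - Uy sg y| <= eta.

(** A base point strictly between the singular point and [sg]: the field is regular from [m] on, and
    the primitive based there is differentiable on both sides of [sg]. *)
Let m := s / 2 + theta mu eps.
(* Freezing the integrands beyond 1 makes them continuous on [m, +oo[. *)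
Let cl (x : R) := Num.min x 1.
Let v x := V a (cl x).
Let h x := (cl x ^+ mu - eps)^-1.
Let g x := v x * h x / x.
Let W x y := U a (cl x) y.
Let Wy x y := Uy (cl x) y.

Let m_sg : m < sg. Proof. by move: s0; rewrite /m /sg; lra. Qed.
Let sg1 : sg < 1. Proof. exact: lt_le_trans d1_1. Qed.
Let th_m : theta mu eps < m. Proof. by move: s0; rewrite /m; lra. Qed.
Let m0 : 0 < m. Proof. exact: le_lt_trans (theta_ge0 _ _) th_m. Qed.

Let cl_id x : x <= 1 -> cl x = x.
Proof. by move=> x1; rewrite /cl min_l. Qed.

Let cl_bound x : m <= x -> m <= cl x <= 1.
Proof. by move=> mx; rewrite /cl le_min mx (ltW (lt_trans m_sg sg1)) ge_min lexx orbT. Qed.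

Let cl01 x : m <= x -> 0 <= cl x <= 1.
Proof. by move=> /cl_bound/andP[mc ->]; rewrite (le_trans (ltW m0) mc). Qed.

Let q_gt0 x : m <= x -> 0 < cl x ^+ mu - eps.
Proof.
by move=> /cl_bound/andP[mc _]; apply: theta_lt_gt0 => //; exact: lt_le_trans mc.
Qed.

Let ccl x : {for x, continuous cl}.
Proof.
apply: continuous_min; [exact: cvg_id|exact: cvg_cst].
Qed.

Let cv x : m <= x -> {for x, continuous v}.
Proof.
by move=> mx; apply: (@continuous_comp _ _ _ cl (V a)); [exact: ccl|apply/cV/cl01].
Qed.

Let ch x : m <= x -> {for x, continuous h}.
Proof.
move=> mx; apply: continuousV; first by rewrite gt_eqF ?q_gt0.
apply: continuousB; last exact: cvg_cst.
by apply: (@continuous_comp _ _ _ cl (fun x => x ^+ mu)); [exact: ccl|exact: exprn_continuous].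
Qed.

Let cg x : m <= x -> {for x, continuous g}.
Proof.
move=> mx; apply: continuousM; first by apply: continuousM; [exact: cv|exact: ch].
by apply: continuousV; [rewrite gt_eqF ?(lt_le_trans m0)|exact: cvg_id].
Qed.

Let v_gt0 x : m <= x -> 0 < v x.
Proof. by move=> /cl01/V_bound/andP[? _]; exact: lt_le_trans v0_gt0 _. Qed.

Let g_ge0 x : m < x -> 0 <= g x.
Proof.
move=> /ltW mx; rewrite divr_ge0 ?mulr_ge0 ?invr_ge0//; apply/ltW.
- exact: v_gt0.
- exact: q_gt0.
- exact: lt_le_trans mx.
Qed.

Let cU2 (F : 'rV[R]_alpha -> R -> R -> R) x y : m < x ->
  {for (a, cl x, y), continuous (fun q : 'rV[R]_alpha * R * R => F q.1.1 q.1.2 q.2)} ->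
  {for (x, y), continuous (fun p : R * R => F a (cl p.1) p.2)}.
Proof.
move=> mx cF.
apply: (@continuous_comp3 _ _ _ _ _ (fun=> a) (fun p : R * R => cl p.1) snd F).
- exact: cvg_cst.
- by apply: (@continuous_comp _ _ _ fst cl); [exact: cvg_fst|exact: ccl].
- exact: cvg_snd.
- exact: cF.
Qed.

(** [y1] is the height [y(d1)] of the trajectory; it is existential because its expression involves
    the auxiliary primitive [E]. The boundary term [- U a sg 1] has already cancelled. *)
Lemma dulac_time_is_derive : exists D y1 : R, [/\
  is_derive s 1 (fun s' => dulac_time U V mu eps a s') D,
  0 < y1, y1 <= sg ^+ 2 / d1 ^+ 2
  & D <= (sg ^+ mu - eps)^-1 * (- U a sg y1 + (eta + L * eta1 + 4 * L * kap)
          + L * v1 / (v0 * sg) * y1)].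
Proof.
have [E [dE intE]] := continuous_primitive cg.
have cE x : m < x -> {for x, continuous E} by move=> mx; exact: is_derive_continuous (dE _ mx).
have rU' x y : m < x -> 0 < y -> y < 1 + r -> regular3 U a (cl x) y.
  by move=> mx; apply: rU; apply: cl01; exact: ltW.
have dF := @is_derive_integral_along_flow R m 1 r sg E g h W Wy r0 m_sg sg1 dE g_ge0
  (fun x mx => cg (ltW mx)) (fun x mx => ch (ltW mx)).
have {}dF := dF
  (fun x y mx y0 y1 => @cU2 U x y mx (let: And3 _ H _ := rU' x y mx y0 y1 in H))
  (fun x y mx y0 y1 => @cU2 (fun a x y => (U a x)^`()%classic y) x y mx
    (let: And3 _ _ H := rU' x y mx y0 y1 in H))
  (fun x y mx y0 y1 => let: And3 H _ _ := rU' x y mx y0 y1 in H).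
have sgE : cl sg = sg by apply: cl_id; exact: ltW.
have msg' x : sg <= x -> m <= x by move=> sx; apply: le_trans sx; exact: ltW.
have sg_gt0 : 0 < sg by exact: lt_trans m_sg.
have h_gt0 x : m < x -> 0 < h x by move=> /ltW mx; rewrite invr_gt0 q_gt0.
have v_bound x : sg <= x <= 1 -> v0 <= v x <= v1.
  by move=> /andP[sx x1]; apply: V_bound; apply: cl01; exact: msg'.
have h_large x : sg <= x <= d1 -> 1 <= kap * (v0 * h x).
  move=> sxd; have /andP[sx xd] := sxd; have qx := q_gt0 (msg' _ sx).
  rewrite mulrA ler_pdivlMr// mul1r cl_id ?(le_trans xd)//; exact: q_small.
set D := (X in is_derive _ _ _ X) in dF.
exists D, (expR (E sg - E d1)); split.
- have dS : is_derive s 1 (fun s' => s' + theta mu eps) 1.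
    by apply: is_derive_eq; rewrite addr0.
  have := @is_derive1_comp R _ (fun s' => s' + theta mu eps) s _ _ dF dS.
  (* The integral with frozen integrands is the Dulac time only while the start stays to the right
     of [m], that is for [s' > s / 2]; this is enough near [s]. *)
  rewrite mulr1; apply: near_eq_is_derive.
  near=> s' => /=.
  have ss' : s / 2 < s' by near: s'; apply: lt_nbhsr; move: s0; lra.
  have msg2 : m <= s' + theta mu eps by rewrite /m lerD2r ltW.
  apply: eq_Rintegral => x /set_mem; rewrite /= in_itv/= => /andP[sx x1].
  rewrite /W /h cl_id//; congr (U _ _ _ / _); rewrite /traj; congr expR.
  rewrite -[LHS]opprB -(intE _ _ msg2 sx); congr (- _).
  apply: eq_Rintegral => t /set_mem; rewrite /= in_itv/= => /andP[st tx].
  have t1 := le_trans tx x1.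
  by rewrite /g /v /h cl_id// invfM mulrA mulrAC.
- exact: expR_gt0.
- exact: (bracket_trajectory_bound m_sg sg_gt0 sg_d1 d1_1 dE (fun _ _ => erefl)
    h_gt0 v0_gt0 kap_ge0 kap_le v_bound h_large).
- have -> : (sg ^+ mu - eps)^-1 = h sg by rewrite /h sgE.
  have -> : U a sg (expR (E sg - E d1)) = W sg (expR (E sg - E d1)) by rewrite /W sgE.
  rewrite /D lerBlDr; apply: le_trans (bracket_integral_bound (W := W) m_sg sg_gt0 sg_d1
    d1_1 dE (fun _ _ => erefl) h_gt0 v0_gt0 L_ge0 eta1_ge0 eta_ge0 eta1_le1 kap_ge0
    kap_le v_bound h_large _ _ _ _ _) _.
  + move=> x /andP[sx xd]; rewrite /v sgE cl_id ?(le_trans xd)//.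
    by apply: V_var; rewrite xd (le_trans (ltW sg_gt0)).
  + move=> y y0 y1; have [] // := rU' sg y m_sg y0.
    by apply: le_lt_trans y1 _; rewrite ltrDl.
  + move=> x y /andP[sx x1] y0 y1; apply: Uy_bound; last by rewrite (ltW y0).
    by apply: cl01; exact: msg'.
  + move=> x y /andP[sx xd] y0 y1; rewrite /Wy sgE cl_id ?(le_trans xd)//.
    by apply: Uy_var; rewrite ?(ltW y0)// xd (le_trans (ltW sg_gt0)).
  + move=> x /andP[sx x1]; have mx := lt_le_trans m_sg sx.
    have cZ : {for x, continuous (fun x => expR (E sg - E x))}.
      apply: (@continuous_comp _ _ _ (fun x => E sg - E x) expR); last exact: continuous_expR.
      by apply: continuousB; [exact: cvg_cst|exact: cE].
    apply: continuousM; last by apply: ch; exact: ltW.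
    apply: continuousM; last by apply: continuousM; [exact: cZ|exact: cvg_cst].
    apply: (@continuous_comp2 _ _ _ _ id _ Wy); [exact: cvg_id|exact: cZ|].
    apply: (@cU2 (fun a x y => (U a x)^`()%classic y)) => //.
    have [] // := rU' x (expR (E sg - E x)) mx (expR_gt0 _).
    apply: (@le_lt_trans _ _ 1); last by rewrite ltrDl.
    rewrite -expR0 ler_expR subr_le0.
    exact: (derive_ge0_nondecreasing dE g_ge0).
  by rewrite [W sg 1 * _]mulrC -mulrDr ler_wpM2l ?(ltW (h_gt0 _ m_sg))//; lra.
Unshelve. all: by end_near. Qed.

End dulac_time_derivative.

(** * Constants uniform in the parameter *)

Section uniform_constants.
Context {R : realType} {alpha : nat}.
Variables (A K : set 'rV[R]_alpha).
Variables (U : 'rV[R]_alpha -> R -> R -> R) (V : 'rV[R]_alpha -> R -> R).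
Hypothesis aU : analytic_on (cube_times 2 A) (pack3 U).
Hypothesis U_gt0 : forall a, A a -> 0 < U a 0 0.
Hypothesis aV : analytic_on (cube_times 1 A) (pack2 V).
Hypothesis V_gt0 : forall a x, A a -> -1 <= x <= 1 -> 0 < V a x.
Hypotheses (cK : compact K) (KA : K `<=` A).
Notation Uy a x y := ((U a x)^`()%classic y).

Let unit_sub (x : R) : 0 <= x <= 1 -> -1 <= x <= 1.
Proof. by move=> /andP[x0 ->]; rewrite (le_trans _ x0)// lerN10. Qed.

Let regU a x y : A a -> 0 <= x <= 1 -> 0 <= y <= 1 -> regular3 U a x y.
Proof.
move=> Aa x1 y1.
exact: (nbhs_singleton (pack3_regular aU Aa (unit_sub x1) (unit_sub y1))).
Qed.

Let contV a x : A a -> 0 <= x <= 1 ->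
  {for (a, x), continuous (fun q : 'rV[R]_alpha * R => V q.1 q.2)}.
Proof. by move=> Aa x1; apply: pack2_continuous aV Aa _; exact: unit_sub. Qed.

Let cpt1 : compact (K `*` `[0, 1]%classic : set ('rV[R]_alpha * R)).
Proof. by apply: compact_setX => //; exact: segment_compact. Qed.

Let near0P (P : R -> Prop) : (\forall x \near (0 : R), P x) ->
  exists2 d : R, 0 < d & forall x, `|x| < d -> P x.
Proof.
by case=> d /= d0 H; exists d => // x xd; apply: H; rewrite /= sub0r normrN.
Qed.

Let u01 : 0 <= (0 : R) <= 1. Proof. by rewrite lexx ler01. Qed.

Lemma uniform_V_bounds : exists v0 v1 : R, [/\ 0 < v0, 0 < v1 &
  forall a x, K a -> 0 <= x <= 1 -> v0 <= V a x <= v1].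
Proof.
have cont q : (K `*` `[0, 1]%classic : set ('rV[R]_alpha * R)) q ->
    {for q, continuous (fun q : 'rV[R]_alpha * R => V q.1 q.2)}.
  by case: q => a x [/= /KA Aa]; rewrite in_itv/=; exact: contV.
have pos q : (K `*` `[0, 1]%classic : set ('rV[R]_alpha * R)) q -> 0 < V q.1 q.2.
  by case: q => a x [/= /KA Aa]; rewrite in_itv/= => /unit_sub; exact: V_gt0.
have [v0 v00 Hv0] := compact_positive_lower_bound cpt1 cont pos.
have [v1 Hv1] := continuous_bounded_compact cpt1 cont.
exists v0, (`|v1| + 1); split => //.
move=> a x Ka x1.
have S : (K `*` `[0, 1]%classic : set ('rV[R]_alpha * R)) (a, x) by split; rewrite //= in_itv.
rewrite (Hv0 _ S)/=; apply: le_trans (ler_norm _) _.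
by apply: le_trans (Hv1 _ S) _; rewrite ler_wpDr// ler_norm.
Qed.

Lemma uniform_Uy_bound : exists2 L : R, 0 < L &
  forall a x y, K a -> 0 <= x <= 1 -> 0 <= y <= 1 -> `|Uy a x y| <= L.
Proof.
have cpt2 : compact (K `*` `[0, 1]%classic `*` `[0, 1]%classic : set ('rV[R]_alpha * R * R)).
  by apply: compact_setX => //; exact: segment_compact.
have cont q : (K `*` `[0, 1]%classic `*` `[0, 1]%classic : set ('rV[R]_alpha * R * R)) q ->
    {for q, continuous (fun q : 'rV[R]_alpha * R * R => Uy q.1.1 q.1.2 q.2)}.
  case: q => -[a x] y [/= [/= /KA Aa]]; rewrite !in_itv/= => x1 y1.
  by have [] := regU Aa x1 y1.
have [L HL] := continuous_bounded_compact cpt2 cont.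
exists (`|L| + 1); first by rewrite ltr_wpDl.
move=> a x y Ka x1 y1; apply: (@le_trans _ _ L); last by rewrite ler_wpDr// ler_norm.
by apply: (HL (a, x, y)); split; [split|]; rewrite //= in_itv.
Qed.

(** Positivity is given only at the origin, so the bound, half of a lower bound for [U a 0 0] over
    [K], is confined to a small square; hence the need for both [sg] and [y(d1)] to be small. *)
Lemma uniform_U_lower_bound : exists u0 d : R, [/\ 0 < u0, 0 < d &
  forall a x y, K a -> `|x| < d -> `|y| < d -> u0 <= U a x y].
Proof.
have c3 a (p : R * R) : K a -> p = (0, 0) ->
    {for (p, a), continuous (fun q : R * R * 'rV[R]_alpha => U q.2 q.1.1 q.1.2)}.
  move=> /KA Aa ->; have [_ cU _] := regU Aa u01 u01.
  apply: (@continuous_comp3 _ _ _ _ _ snd (fun q : R * R * 'rV[R]_alpha => q.1.1)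
    (fun q => q.1.2) U).
  - exact: cvg_snd.
  - by apply: (@continuous_comp _ _ _ fst fst); exact: cvg_fst.
  - by apply: (@continuous_comp _ _ _ fst snd); [exact: cvg_fst|exact: cvg_snd].
  - exact: cU.
have [a Ka||l l0 Hl] := @compact_positive_lower_bound R _ K (fun a => U a 0 0) cK.
- have [_ cU _] := regU (KA Ka) u01 u01.
  apply: (@continuous_comp3 _ _ R R _ id (fun=> 0) (fun=> 0) U).
  + exact: cvg_id.
  + exact: cst_continuous.
  + exact: cst_continuous.
  + exact: cU.
- by move=> a /KA; exact: U_gt0.
have l2 : 0 < l / 2 by rewrite divr_gt0.
have := @compact_equicontinuous R (R * R)%type _ K (0, 0) (fun p a => U a p.1 p.2) _ l2 cK
  (fun a Ka => c3 a (0, 0) Ka erefl).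
move=> /nbhs_ballP[d /= d0 Hd].
exists (l / 2), d; split => // a x y Ka xd yd.
have := Hd (x, y) _ a Ka; rewrite /= ler_norml => /(_ _)/andP[].
  by split; rewrite /ball/= sub0r normrN.
by have := Hl _ Ka => *; lra.
Qed.

(** Both values are compared with the one at [x = 0], each at the cost of [e / 2]; uniformity in [a]
    and [y] comes from compactness of [K] and of [K] times [[0, 1]]. *)
Lemma uniform_variation (e : R) : 0 < e -> exists2 d : R, 0 < d &
  forall a x x', K a -> 0 <= x < d -> 0 <= x' < d ->
    `|V a x - V a x'| <= e /\
    forall y, 0 <= y <= 1 -> `|Uy a x y - Uy a x' y| <= e.
Proof.
move=> e0; have e2 : 0 < e / 2 by rewrite divr_gt0.
have c1 a : K a -> {for ((0 : R), a), continuous (fun q : R * 'rV[R]_alpha => V q.2 q.1)}.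
  move=> /KA Aa; have cV := contV Aa u01.
  apply: (@continuous_comp2 _ _ _ _ snd fst V);
    [exact: cvg_snd|exact: cvg_fst|exact: cV].
have c2 q : (K `*` `[0, 1]%classic : set ('rV[R]_alpha * R)) q ->
    {for ((0 : R), q), continuous (fun p : R * ('rV[R]_alpha * R) => Uy p.2.1 p.1 p.2.2)}.
  case: q => a y [/= /KA Aa]; rewrite in_itv/= => y1.
  have [_ _ cU] := regU Aa u01 y1.
  apply: (@continuous_comp3 _ _ _ _ _ (fun p : R * ('rV[R]_alpha * R) => p.2.1) fst
    (fun p => p.2.2) (fun a x y => Uy a x y)).
  - by apply: (@continuous_comp _ _ _ snd fst); [exact: cvg_snd|exact: cvg_fst].
  - exact: cvg_fst.
  - by apply: (@continuous_comp _ _ _ snd snd); exact: cvg_snd.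
  - exact: cU.
have [dV dV0 HV] := near0P (@compact_equicontinuous R R _ K 0 (fun x a => V a x) _ e2 cK c1).
have [dU dU0 HU] := near0P (@compact_equicontinuous R R _ _ 0
  (fun x (q : 'rV[R]_alpha * R) => Uy q.1 x q.2) _ e2 cpt1 c2).
exists (Num.min dV dU); first by rewrite lt_min dV0.
move=> a x x' Ka; rewrite !lt_min => /and3P[x0 xV xU] /and3P[x'0 x'V x'U].
have tri (p q t : R) : `|p - t| <= e / 2 -> `|q - t| <= e / 2 -> `|p - q| <= e.
  by rewrite !ler_norml => /andP[? ?] /andP[? ?]; apply/andP; split; lra.
split=> [|y y1].
  by apply: (tri _ _ (V a 0)); apply: HV; rewrite ?ger0_norm.
have S : (K `*` `[0, 1]%classic : set ('rV[R]_alpha * R)) (a, y) by split; rewrite //= in_itv.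
by apply: (tri _ _ (Uy a 0 y)); [apply: (HU x _ (a, y))|apply: (HU x' _ (a, y))];
  rewrite ?ger0_norm.
Qed.

(** Compactness of the segment [y = 1] provides the room above it. The width may depend on [a],
    since it serves the existence of the derivative and enters no bound. *)
Lemma regular_tube a : A a -> exists2 r : R, 0 < r &
  forall x y, 0 <= x <= 1 -> 0 < y -> y < 1 + r -> regular3 U a x y.
Proof.
move=> Aa.
have := (compact_near_coveringP _).1 (@segment_compact R 0 1) _ (nbhs (1 : R))
  (fun y x => regular3 U a x y) _.
case=> [x /=|r /= r0 Hr].
  rewrite in_itv/= => x1.
  have one : 0 <= (1 : R) <= 1 by rewrite ler01 lexx.
  have /nbhs_ballP[d /= d0 Hd] := pack3_regular aU Aa (unit_sub x1) (unit_sub one).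
  exists (ball (x : R) d, ball (1 : R) d); first by split; exact: nbhsx_ballx.
  move=> [x' y'] [/= bx by'].
  by apply: (Hd (a, x', y')); split => //; split => //; exact: ballxx.
exists r => // x y x1 y0 yr; have [y1|y1] := leP y 1.
  by apply: regU => //; rewrite (ltW y0).
apply: (Hr y) => /=; last by rewrite in_itv.
by rewrite ltr_norml; apply/andP; split; lra.
Qed.

End uniform_constants.

(** * Choice of the thresholds *)

Unset Implicit Arguments.

Theorem theoremA (R : realType) (mu alpha : nat) (A : set 'rV[R]_alpha)
  (U : 'rV[R]_alpha -> R -> R -> R) (V : 'rV[R]_alpha -> R -> R) :
  (0 < mu)%N ->
  open A ->
  analytic_on (cube_times 2 A) (pack3 U) ->
  (forall a, A a -> 0 < U a 0 0) ->
  (forall a, A a -> taylor_abs_conv_square (U a)) ->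
  analytic_on (cube_times 1 A) (pack2 V) ->
  (forall a x, A a -> -1 <= x <= 1 -> 0 < V a x) ->
  forall K : set 'rV[R]_alpha, compact K -> K `<=` A ->
  forall M : R, exists delta : R, 0 < delta /\
    forall (s eps : R) (a : 'rV[R]_alpha),
      0 < s < delta -> `|eps| < delta -> K a ->
      derivable (fun s' => dulac_time U V mu eps a s') s 1 /\
      derive1 (fun s' => dulac_time U V mu eps a s') s < - M.
Proof.
move=> mu0 _ aU U_gt0 _ aV V_gt0 K cK KA M.
have [v0 [v1 [v00 v10 Vb]]] := uniform_V_bounds aV V_gt0 cK KA.
have [L L0 Lb] := uniform_Uy_bound aU cK KA.
have [u0 [du [u00 du0 Ub]]] := uniform_U_lower_bound aU U_gt0 cK KA.
(* Four errors share half of [u0] equally: [eta], [L * eta1], [4 * L * kap] and the contribution of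
   [[d1, 1]] each get [u0 / 8]. *)
pose eta := u0 / 8.
pose eta1 := Num.min 1 (u0 / (8 * L)).
pose kap := Num.min (1 / 2) (u0 / (32 * L)).
have eta0 : 0 < eta by rewrite divr_gt0.
have eta10 : 0 < eta1 by rewrite lt_min ltr01 divr_gt0// mulr_gt0.
have kap0 : 0 < kap by rewrite lt_min !divr_gt0// mulr_gt0.
have eta1_1 : eta1 <= 1 by rewrite ge_min lexx.
have kap2 : kap <= 1 / 2 by rewrite ge_min lexx.
have Leta1 : L * eta1 <= u0 / 8.
  apply: (@le_trans _ _ (L * (u0 / (8 * L)))).
    by rewrite ler_pM2l// ge_min lexx orbT.
  by rewrite (_ : L * _ = u0 / 8)//; field; rewrite gt_eqF.
have Lkap : 4 * L * kap <= u0 / 8.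
  apply: (@le_trans _ _ (4 * L * (u0 / (32 * L)))).
    by rewrite ler_pM2l ?mulr_gt0// ge_min lexx orbT.
  by rewrite (_ : 4 * L * _ = u0 / 8)//; field; rewrite gt_eqF.
have e0 : 0 < Num.min eta (eta1 * v0) by rewrite lt_min eta0 mulr_gt0.
have [d d0 var] := uniform_variation aU aV cK KA e0.
(* The bound [q(x) <= x + |eps| <= kap * v0] is split in halves between [d1] and [eps]. *)
pose d1 := Num.min (d / 2) (Num.min (1 / 2) (kap * v0 / 2)).
have d10 : 0 < d1 by rewrite !lt_min !divr_gt0// mulr_gt0.
have d1d : d1 < d by apply: (@le_lt_trans _ _ (d / 2)); [rewrite ge_min lexx|lra].
have d1_1 : d1 <= 1.
  by apply: (@le_trans _ _ (1 / 2)); [rewrite !ge_min lexx orbT|lra].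
have d1k : d1 <= kap * v0 / 2 by rewrite !ge_min lexx !orbT.
pose M1 := `|M| + 1.
have M10 : 0 < M1 by rewrite ltr_wpDl.
have M_M1 : M < M1 by apply: le_lt_trans (ler_norm M) _; rewrite ltrDl.
clearbody kap eta1 d1 M1.
(* The entry [d1 * du] gives [y1 <= (sg / d1)^2 <= sg / d1 < du]; the next one bounds
   [L * v1 * sg / (v0 * d1^2)] by the fourth share [u0 / 8]; the last, with its counterpart for
   [eps], gives [q(sg) < u0 / (2 * M1)]. *)
pose sg1 := Num.min d1 (Num.min du (Num.min (d1 * du)
  (Num.min (u0 * v0 * d1 ^+ 2 / (8 * L * v1)) (u0 / (4 * M1))))).
have sg10 : 0 < sg1.
  by rewrite !lt_min d10 du0 !divr_gt0 ?mulr_gt0 ?exprn_gt0.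
(* Half of [sg1] goes to [s] and half to [theta], the latter through [eps < (sg1 / 2) ^+ mu]. *)
pose delta := Num.min (sg1 / 2) (Num.min ((sg1 / 2) ^+ mu)
  (Num.min (kap * v0 / 2) (u0 / (4 * M1)))).
exists delta; split.
  by rewrite lt_min divr_gt0// lt_min exprn_gt0 ?divr_gt0// lt_min !divr_gt0 ?mulr_gt0.
move=> s eps a /andP[s0]; rewrite !lt_min => /and4P[s1 _ _ _].
move=> /and4P[_ eps1 eps2 eps3] Ka.
have th : theta mu eps < sg1 / 2.
  by apply: theta_small; rewrite ?divr_gt0//; exact: le_lt_trans (ler_norm _) eps1.
have th0 := theta_ge0 mu eps.
set sg := s + theta mu eps.
have sg0 : 0 < sg by rewrite /sg; lra.
have : sg < sg1 by rewrite /sg; lra.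
rewrite !lt_min => /and5P[sg_d1 sg_du sg_d1du sg_L sg_M].
have pow_le (x : R) : 0 <= x -> x <= 1 -> x ^+ mu <= x.
  by move=> x0 x1; rewrite -(prednK mu0) exprS ler_piMr// exprn_ile1.
have neps : - eps <= `|eps| by rewrite -normrN ler_norm.
have [r r0 reg] := regular_tube aU (KA _ Ka).
have cVa x : 0 <= x <= 1 -> {for x, continuous (V a)}.
  move=> /andP[x0 x1].
  have x11 : -1 <= x <= 1 by rewrite x1 (le_trans _ x0)// lerN10.
  apply: (@continuous_comp2 _ _ _ _ (fun=> a) id V).
  - exact: cst_continuous.
  - exact: cvg_id.
  - exact: pack2_continuous aV (KA _ Ka) x11.
have q_small x : sg <= x <= d1 -> x ^+ mu - eps <= kap * v0.
  move=> /andP[sx xd].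
  have := pow_le x (le_trans (ltW sg0) sx) (le_trans xd d1_1).
  by move=> *; lra.
have V_var x : 0 <= x <= d1 -> `|V a sg - V a x| <= eta1 * v0.
  move=> /andP[x0 xd]; have [] := var a sg x Ka.
  - by rewrite (ltW sg0) (lt_trans sg_d1).
  - by rewrite x0 (le_lt_trans xd).
  by rewrite le_min => /andP[].
have Uy_var x y : 0 <= x <= d1 -> 0 <= y <= 1 ->
    `|(U a x)^`()%classic y - (U a sg)^`()%classic y| <= eta.
  move=> /andP[x0 xd] y1; have [||_] := var a x sg Ka.
  - by rewrite x0 (le_lt_trans xd).
  - by rewrite (ltW sg0) (lt_trans sg_d1).
  by move=> /(_ _ y1); rewrite le_min => /andP[].
have [D [y1 [dD y10 y1b Db]]] := dulac_time_is_derive mu0 s0 r0 sg_d1 d1_1 cVa reg v00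
  (ltW L0) (ltW eta10) (ltW eta0) eta1_1 (ltW kap0) kap2
  (fun x x1 => Vb a x Ka x1) q_small V_var (fun x y x1 y1 => Lb a x y Ka x1 y1) Uy_var.
have [derD valD] := dD; split => //; rewrite derive1E valD.
have q0 : 0 < sg ^+ mu - eps by apply: theta_lt_gt0 => //; rewrite /sg ltrDr.
have sgd : sg / d1 <= 1 by rewrite ler_pdivrMr// mul1r ltW.
have y1du : y1 < du.
  apply: le_lt_trans y1b _; rewrite -expr_div_n expr2.
  apply: (@le_lt_trans _ _ (sg / d1)).
    by rewrite ler_piMr// divr_ge0// ltW.
  by rewrite ltr_pdivrMr// mulrC.
have U1 : u0 <= U a sg y1.
  by apply: Ub => //; rewrite gtr0_norm.
have last_term : L * v1 / (v0 * sg) * y1 <= u0 / 8.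
  apply: (@le_trans _ _ (L * v1 / (v0 * sg) * (sg ^+ 2 / d1 ^+ 2))).
    by rewrite ler_pM2l// divr_gt0// mulr_gt0.
  have -> : L * v1 / (v0 * sg) * (sg ^+ 2 / d1 ^+ 2) = sg * (L * v1 / (v0 * d1 ^+ 2)).
    by field; rewrite !gt_eqF.
  rewrite -ler_pdivlMr ?divr_gt0 ?mulr_gt0 ?exprn_gt0//.
  apply: le_trans (ltW sg_L) _; rewrite le_eqVlt; apply/orP; left; apply/eqP.
  by field; rewrite !gt_eqF.
have q_le : sg ^+ mu - eps < u0 / (2 * M1).
  have := pow_le sg (ltW sg0) (le_trans (ltW sg_d1) d1_1).
  have -> : u0 / (2 * M1) = u0 / (4 * M1) + u0 / (4 * M1) by field; rewrite gt_eqF.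
  by move=> *; lra.
apply: le_lt_trans Db _.
apply: (@le_lt_trans _ _ ((sg ^+ mu - eps)^-1 * (- (u0 / 2)))).
  by rewrite ler_pM2l ?invr_gt0//; rewrite /eta; lra.
rewrite mulrN ltrN2; apply: (lt_trans M_M1).
rewrite mulrC ltr_pdivlMr// mulrC -ltr_pdivlMr//.
by rewrite (_ : u0 / 2 / M1 = u0 / (2 * M1))// invfM mulrA.
Qed.
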